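(* Let $M>0$ be a real number and let $\mu$ be a probability distribution on $\{-\infty\}\cup\mathbb{R}$ with $\mu([-\infty,M))=1$. Then the map $p\mapsto C((1-p)\mu+p\delta_M)$ is analytic on $(0,1]$.
   Context: $\delta_x$ is the Dirac measure at $x$. For a probability distribution $\nu$ on $\{-\infty\}\cup\mathbb{R}$, let $(X_{i,j})_{0\le i<j}$ be i.i.d. random variables with distribution $\nu$, where $X_{i,j}$ is the weight of the directed edge $(i,j)$ of the complete directed acyclic graph on the non-negative integers. A directed path is a sequence of integers $\pi=(i_1,\dots,i_k)$ with $0\le i_1<\dots<i_k$; its weight is $w_\pi=X_{i_1,i_2}+\dots+X_{i_{k-1},i_k}$. Let $W_n=\max\{w_\pi : \pi=(i_1,\dots,i_k) \text{ a directed path with } i_1=0,\ i_k=n\}$. Then $W_n/n$ converges almost surely to a deterministic constant $C(\nu)\in\mathbb{R}\cup\{\pm\infty\}$, called the time constant for last passage percolation. A function on a (not necessarily open) set $D$ is analytic on $D$ if near each point of $D$ it coincides on $D$ with the sum of a power series converging in a neighbourhood of that point. *)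

(* Defs.v *)
From HB Require Import structures.
From mathcomp Require Import all_boot all_order all_algebra finmap.
From mathcomp Require Import all_classical all_reals all_analysis measurable_realfun.

Set Implicit Arguments.
Unset Strict Implicit.
Unset Printing Implicit Defensive.

Import Order.TTheory GRing.Theory Num.Theory.
Import numFieldNormedType.Exports.

Local Open Scope classical_set_scope.
Local Open Scope ring_scope.

(* A function with values in [\bar R] can only be analytic on [D] if it is
   finite there.  The power series has to converge at every point within
   distance [r] of [x0], also outside [D]; the equality with [f] is only
   required on [D]. *)
Definition analytic_on (R : realType) (D : set R) (f : R -> \bar R) : Prop :=
  forall x0, D x0 ->
  exists (a : nat -> R) (r : R),
    [/\ 0 < r,
        forall y, `|y| < r -> cvgn (pseries a y) &
        forall x, D x -> `|x - x0| < r ->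
          f x = (limn (pseries a (x - x0)))%:E].

Definition mutually_independent d (T : measurableType d) (R : realType)
    (P : probability T R) (I : choiceType) (D : set I)
    (X : I -> {RV P >-> \bar R}) : Prop :=
  forall s : {fset I}, [set` s] `<=` D ->
  forall B : I -> set (\bar R), (forall i, measurable (B i)) ->
    P (\bigcap_(i in [set` s]) (X i @^-1` B i)) =
    (\prod_(i <- s) P (X i @^-1` B i))%E.

Definition edges : set (nat * nat) := [set e | (e.1 < e.2)%N].

(* [X (i, j)] is the weight of the edge [(i, j)]; the values of [X] outside
   [edges] are irrelevant. *)
Definition iid_edge_weights d (T : measurableType d) (R : realType)
    (P : probability T R) (nu : set (\bar R) -> \bar R)
    (X : nat * nat -> {RV P >-> \bar R}) : Prop :=
  mutually_independent edges X /\
  forall e, edges e -> forall B, measurable B -> distribution P (X e) B = nu B.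

Definition path_weight (R : realType) (x : nat * nat -> \bar R)
    (pi : seq nat) : \bar R :=
  (\sum_(e <- zip pi (behead pi)) x e)%E.

Definition directed_paths (m n : nat) : set (seq nat) :=
  [set pi | [/\ sorted ltn pi, ohead pi = Some m & last m pi = n]].

(* There are finitely many paths from 0 to n, and at least one, so the
   supremum is a maximum. *)
Definition last_passage (R : realType) (x : nat * nat -> \bar R)
    (n : nat) : \bar R :=
  ereal_sup [set path_weight x pi | pi in directed_paths 0 n].

(* The law of the whole family of weights is determined by [nu], hence so is
   [c], and one realization of the family suffices. *)
Definition is_time_constant (R : realType) (nu : set (\bar R) -> \bar R)
    (c : \bar R) : Prop :=
  exists (d : measure_display) (T : measurableType d) (P : probability T R)
         (X : nat * nat -> {RV P >-> \bar R}),
    iid_edge_weights nu X /\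
    {ae P, forall t,
      ((last_passage (fun e => X e t) n * (n%:R^-1)%:E)%E @[n --> \oo] --> c)}.

Definition mixture (R : realType) (mu : probability (\bar R) R) (M p : R) :
    set (\bar R) -> \bar R :=
  fun A => ((1 - p)%:E * mu A + p%:E * \d_(M%:E) A)%E.

(* Main.v *)
Require Import Defs.
From mathcomp Require Import all_boot all_order all_algebra finmap.
From mathcomp Require Import all_classical all_reals all_analysis measurable_realfun.
From mathcomp Require Import ring lra.

Set Implicit Arguments.
Unset Strict Implicit.
Unset Printing Implicit Defensive.

Import Order.TTheory GRing.Theory Num.Theory.
Import numFieldNormedType.Exports.

Local Open Scope classical_set_scope.
Local Open Scope ring_scope.

(** Explore the vertices in order.  The weight of a new vertex is obtained by
    scanning the earlier vertices by decreasing weight; the scan may stop at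
    the first edge of weight M, since no later candidate can do better.  Only a
    geometric number of edges is thus inspected per vertex, so that an
    expectation becomes a combination of monomials p^a (1-p)^b, with total mass
    close to 1 even when p and 1-p are replaced by the norms p0 + r and
    1 - p0 + r of the polynomials p0 + h and 1 - p0 - h.

    Two decreasing lists of vertex weights sharing, up to a shift, their k top
    entries share k+1 of them after one step unless the scan goes beyond depth
    k, which has mass y^k for y = 1 - p0 + r.  Hence the expected gains of the
    front in successive steps form a telescoping series converging
    geometrically in the norm sum_i |P_i| r^i.  The expected front divided by n
    is therefore a polynomial in p - p0 whose norm is bounded uniformly in n
    and in the law of the weights.  Quantizing the weights with mesh M/(n+1)
    changes the front by at most M and makes everything finite.  A compactness
    argument on the coefficients turns the pointwise limit into a power
    series. *)

(** * Weighted coefficient norm of polynomials *)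

Section PolyNorm.
Context {R : realFieldType}.
Implicit Types (P : {poly R}) (r C : R).

(* Quantifying over [N] spares us the dependence on [size P]. *)
Definition poly_norm_le r C P := forall N, \sum_(i < N) `|P`_i| * r ^+ i <= C.

Lemma poly_norm_leW r C C' P : C <= C' -> poly_norm_le r C P ->
  poly_norm_le r C' P.
Proof. by move=> CC' h N; apply: le_trans (h N) CC'. Qed.

Lemma poly_norm_ge0 r C P : poly_norm_le r C P -> 0 <= C.
Proof. by move=> /(_ 0); rewrite big_ord0. Qed.

Lemma poly_norm_leC r c : poly_norm_le r `|c| c%:P.
Proof.
case=> [|N]; first by rewrite big_ord0.
rewrite big_ord_recl big1 ?addr0 ?coefC ?expr0 ?mulr1// => i _.
by rewrite coefC/= normr0 mul0r.
Qed.

Lemma poly_norm_leD r C C' P P' : 0 <= r ->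
  poly_norm_le r C P -> poly_norm_le r C' P' ->
  poly_norm_le r (C + C') (P + P').
Proof.
move=> r0 h h' N; apply: le_trans (lerD (h N) (h' N)).
rewrite -big_split; apply: ler_sum => i _ /=.
by rewrite coefD -mulrDl ler_wpM2r ?exprn_ge0// ler_normD.
Qed.

Lemma poly_norm_leZ r C c P : poly_norm_le r C P ->
  poly_norm_le r (`|c| * C) (c *: P).
Proof.
move=> h N; apply: le_trans (ler_wpM2l (normr_ge0 c) (h N)).
by rewrite mulr_sumr; apply: ler_sum => i _; rewrite coefZ normrM mulrA.
Qed.

Lemma poly_norm_leXM r C P : 0 <= r -> poly_norm_le r C P ->
  poly_norm_le r (r * C) ('X * P).
Proof.
move=> r0 h [|N].
  by rewrite big_ord0 mulr_ge0// (poly_norm_ge0 h).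
rewrite big_ord_recl coefXM eqxx normr0 mul0r add0r.
apply: le_trans (ler_wpM2l r0 (h N)); rewrite mulr_sumr.
by apply: ler_sum => i _; rewrite coefXM/= exprS mulrCA.
Qed.

Lemma poly_norm_leN r C P : poly_norm_le r C P -> poly_norm_le r C (- P).
Proof. by move=> /(poly_norm_leZ (-1)); rewrite normrN1 mul1r scaleN1r. Qed.

Lemma poly_norm_le_sum (I : finType) r (C : I -> R) (P : I -> {poly R}) :
  0 <= r -> (forall i, poly_norm_le r (C i) (P i)) ->
  poly_norm_le r (\sum_i C i) (\sum_i P i).
Proof.
move=> r0 h; apply: (big_rec2 (fun P C => poly_norm_le r C P)).
  by move=> N; rewrite big1// => i _; rewrite coef0 normr0 mul0r.
by move=> i C' P' _ h'; apply: poly_norm_leD.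
Qed.

Lemma poly_norm_coef r C P k : 0 <= r -> poly_norm_le r C P ->
  `|P`_k| * r ^+ k <= C.
Proof.
move=> r0 /(_ k.+1); apply: le_trans; rewrite big_ord_recr/= lerDr.
by apply: sumr_ge0 => i _; rewrite mulr_ge0// exprn_ge0.
Qed.

End PolyNorm.

(** * Summability of the coupling bounds *)

Section CouplingBound.
Context {R : realType}.

(* Bounds the distance of the expected gains after [n] steps from two lists
   sharing their [k] top entries; a scan going deeper than [k] leaves only the
   top entry in common, after a shift. *)
Fixpoint coupling_bound (M L y : R) n k : R :=
  if n is n'.+1 then
    L * ((1 - y ^+ k) * coupling_bound M L y n' k.+1 +
         y ^+ k * coupling_bound M L y n' 1)
  else L * (y ^+ k * M).

(* The mass of the sequences of at most [n] steps that ever lose the [k] common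
   entries; for [L = 1] it stays away from 1 because the product of the
   [1 - y ^+ i] converges. *)
Fixpoint return_mass (L y : R) n k : R :=
  if n is n'.+1 then
    L * ((1 - y ^+ k) * return_mass L y n' k.+1 + y ^+ k)
  else 0.

(** For [L = 1] this is a genuine probability: its complement keeps the common entries through [n]
    steps, at the successive depths [k], [k + 1], etc. *)
Lemma return_mass1 y n k :
  1 - return_mass 1 y n k = \prod_(i < n) (1 - y ^+ (k + i)).
Proof.
elim: n k => [|n IH] k; first by rewrite big_ord0 /= subr0.
rewrite big_ord_recl /= addn0 mul1r.
under eq_bigr do rewrite /bump/= add1n addnS -addSn.
by rewrite -IH; ring.
Qed.

Lemma return_mass1_ge0 y n k : 0 <= y < 1 -> 0 <= return_mass 1 y n k.
Proof.
move=> /andP[y0 y1]; elim: n k => [//|n IH] k /=.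
have k1 : y ^+ k <= 1 by rewrite exprn_ile1// ltW.
by rewrite mul1r addr_ge0 ?mulr_ge0 ?exprn_ge0// subr_ge0.
Qed.

(** A union bound: the losses at depths [k], [k + 1], etc. form a geometric series. *)
Lemma return_mass1_le y n k : 0 <= y < 1 ->
  return_mass 1 y n k <= y ^+ k / (1 - y).
Proof.
move=> /andP[y0 y1]; elim: n k => [|n IH] k /=.
  by rewrite divr_ge0 ?exprn_ge0// subr_ge0 ltW.
have y1' : 1 - y != 0 by rewrite subr_eq0 gt_eqF.
rewrite mul1r; have -> : y ^+ k / (1 - y) = y ^+ k.+1 / (1 - y) + y ^+ k.
  by rewrite exprS; field.
rewrite lerD2r; apply: le_trans (IH k.+1).
have rm0 : 0 <= return_mass 1 y n k.+1 by apply: return_mass1_ge0; rewrite y0.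
by rewrite ler_piMl// lerBlDr lerDl exprn_ge0.
Qed.

(** By the union bound the factors beyond some [N] have product at least 1/2, so half the product of
    the first [N] factors serves as [c]. *)
Lemma prod_one_sub_expr_gt0 y : 0 <= y < 1 ->
  exists2 c : R, 0 < c & forall n, c <= \prod_(i < n) (1 - y ^+ i.+1).
Proof.
move=> /andP[y0 y1].
have f0 i : 0 < 1 - y ^+ i.+1 by rewrite subr_gt0 exprn_ilt1.
have f1 i : 1 - y ^+ i.+1 <= 1 by rewrite lerBlDr lerDl exprn_ge0.
have [N hN] : exists N, y ^+ N.+1 / (1 - y) <= 2^-1.
  have : (fun n => y ^+ n) @ \oo --> (0 : R).
    by apply: cvg_expr; rewrite ger0_norm.
  move=> /cvgrPdist_le/(_ ((1 - y) / 2)) []; first by rewrite divr_gt0// subr_gt0.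
  move=> N _ /(_ N.+1 (leqnSn N)) /=.
  rewrite sub0r normrN ger0_norm ?exprn_ge0// => h.
  by exists N; rewrite ler_pdivrMr ?subr_gt0// mulrC.
exists (\prod_(i < N) (1 - y ^+ i.+1) / 2).
  by rewrite divr_gt0// prodr_gt0.
move=> n; apply: (@le_trans _ _ (\prod_(i < N + n) (1 - y ^+ i.+1))).
  rewrite big_split_ord/= ler_pM2l ?prodr_gt0//.
  under eq_bigr do rewrite -addSn.
  rewrite -return_mass1.
  have /= := @return_mass1_le y n N.+1; rewrite y0 y1 => /(_ isT).
  by move: hN; set u := return_mass _ _ _ _; set w := _ / _; lra.
rewrite addnC big_split_ord/= ler_piMr ?prodr_ge0// => [i _|]; first exact: ltW.
by apply: prodr_ile1 => i; rewrite f1 ltW.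
Qed.

(** The excess over the case [L = 1] is at most [A * y ^+ k], where [A] solves
    [A = (L - 1) / (1 - y) + L * A * y]; this is what closes the induction. *)
Lemma return_mass_le L y n k : 0 <= y < 1 -> 1 <= L -> L * y < 1 ->
  return_mass L y n k <=
    return_mass 1 y n k + (L - 1) / ((1 - y) * (1 - L * y)) * y ^+ k.
Proof.
move=> /andP[y0 y1] L1 Ly1; set A := _ / _.
have L10 : 0 <= L - 1 by lra.
have A0 : 0 <= A by apply: divr_ge0 => //; apply: mulr_ge0; lra.
elim: n k => [|n IH] k; first by rewrite add0r mulr_ge0 ?exprn_ge0.
have k1 : 0 <= 1 - y ^+ k by rewrite subr_ge0 exprn_ile1// ltW.
have := @return_mass1_le y n.+1 k; rewrite y0 y1 => /(_ isT) h1.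
have h2 : (L - 1) * (y ^+ k / (1 - y)) + L * (A * y ^+ k.+1) = A * y ^+ k.
  rewrite /A exprS; field; rewrite !subr_eq0 !gt_eqF//=.
have h3 : (1 - y ^+ k) * (A * y ^+ k.+1) <= A * y ^+ k.+1.
  apply: ler_piMl; last by rewrite lerBlDr lerDl exprn_ge0.
  by rewrite (mulr_ge0 A0)// exprn_ge0.
have L0 : 0 <= L by apply: le_trans L1.
apply: (@le_trans _ _ (L * (return_mass 1 y n.+1 k + A * y ^+ k.+1))).
  rewrite [return_mass L _ _ _]/= ler_wpM2l//= mul1r addrAC lerD2r.
  apply: le_trans (ler_wpM2l k1 (IH _)) _.
  by rewrite mulrDr lerD2l.
rewrite -h2 mulrDr addrA lerD2r.
have := ler_wpM2l (_ : 0 <= L - 1) h1; rewrite subr_ge0 => /(_ L1); lra.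
Qed.

(** A renewal argument: each loss of the common entries restarts the sum at depth 1. As the mass of
    such losses is at most [1 - c], the total is at most a bound on the cost of one period, divided
    by [c]. *)
Lemma sum_coupling_bound_le M L y c n : 0 <= y < 1 -> 1 <= L -> L * y < 1 ->
  0 <= M -> 0 < c -> (forall i, return_mass L y i 1 <= 1 - c) ->
  \sum_(j < n) coupling_bound M L y j 1 <= M * L * y / (1 - L * y) / c.
Proof.
move=> /andP[y0 y1] L1 Ly1 M0 c0 hc; set K := _ / c.
have L0 : 0 <= L by apply: le_trans L1.
have d0 : 0 < 1 - L * y by rewrite subr_gt0.
have K0 : 0 <= K by rewrite !divr_ge0 ?mulr_ge0// ltW.
(* The induction bears on all depths; at depth 1 the bound is at most [K * (1 - c) + K * c], hence
   [K] again. *)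
suff h N k : \sum_(j < N) coupling_bound M L y j k <=
    K * return_mass L y N k + M * L * y ^+ k / (1 - L * y).
  apply: le_trans (h n 1) _; rewrite expr1.
  have -> : M * L * y / (1 - L * y) = K * c by rewrite /K divfK// gt_eqF.
  by rewrite -mulrDr ler_piMr//; have := hc n; lra.
elim: N k => [|N IH] k.
  by rewrite big_ord0 mulr0 add0r divr_ge0 ?mulr_ge0 ?exprn_ge0// ltW.
have S1 : \sum_(j < N) coupling_bound M L y j 1 <= K.
  apply: le_trans (IH 1) _; rewrite expr1.
  have -> : M * L * y / (1 - L * y) = K * c by rewrite /K divfK// gt_eqF.
  by rewrite -mulrDr ler_piMr//; have := hc N; lra.
have k1 : 0 <= 1 - y ^+ k by rewrite subr_ge0 exprn_ile1// ltW.
have yk : 0 <= y ^+ k by rewrite exprn_ge0.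
rewrite big_ord_recl /=.
have -> : \sum_(i < N) L * ((1 - y ^+ k) * coupling_bound M L y i k.+1 +
      y ^+ k * coupling_bound M L y i 1) =
    L * ((1 - y ^+ k) * (\sum_(i < N) coupling_bound M L y i k.+1) +
         y ^+ k * (\sum_(i < N) coupling_bound M L y i 1)).
  by rewrite -mulr_sumr big_split/= -!mulr_sumr.
have h1 := ler_wpM2l k1 (IH k.+1).
have h2 := ler_wpM2l yk S1.
have h3 := ler_wpM2l L0 (lerD h1 h2).
have h4 : (1 - y ^+ k) * (M * L * y ^+ k.+1 / (1 - L * y)) <=
    M * L * y ^+ k.+1 / (1 - L * y).
  apply: ler_piMl; last by rewrite lerBlDr lerDl.
  by rewrite divr_ge0 ?mulr_ge0 ?exprn_ge0 ?(ltW d0).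
have h5 := ler_wpM2l L0 h4.
have h6 : M * L * y ^+ k / (1 - L * y) =
   L * (y ^+ k * M) + L * (M * L * y ^+ k.+1 / (1 - L * y)).
  by rewrite exprS; field; rewrite gt_eqF.
rewrite h6; apply: le_trans (lerD (lexx _) h3) _; lra.
Qed.

Lemma coupling_bound_summable (M p : R) : 0 <= M -> 0 < p <= 1 ->
  exists r K : R, [/\ 0 < r, r < p & forall n, \sum_(j < n)
    coupling_bound M ((p + r) / (1 - (1 - p + r))) (1 - p + r) j 1 <= K].
Proof.
move=> M0 /andP[p0 p1].
(* [1 - p / 2] will bound [y = 1 - p + r], so that [c] can be fixed before [r]. *)
have [c c0 hc] : exists2 c : R, 0 < c &
    forall n, c <= \prod_(i < n) (1 - (1 - p / 2) ^+ i.+1).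
  by apply: prod_one_sub_expr_gt0; lra.
have c1 : c <= 1 by have := hc 0; rewrite big_ord0.
(* With [L - 1 <= 4 * r / p] and [(1 - y) * (1 - L * y) >= p ^+ 2 / 4], this value makes the excess
   of [return_mass] over the case [L = 1] at most [c / 2]. *)
pose r := c * p ^+ 3 / 32.
have p30 : 0 < p ^+ 3 by rewrite exprn_gt0.
have r0 : 0 < r by rewrite divr_gt0 ?mulr_gt0.
have rp2 : r <= p ^+ 2 / 32.
  rewrite ler_pM2r ?invr_gt0// exprSr mulrA.
  have : c * p ^+ 2 <= p ^+ 2 by rewrite ler_piMl ?exprn_ge0// ltW.
  have : 0 <= c * p ^+ 2 by rewrite mulr_ge0 ?exprn_ge0 ?ltW.
  nra.
have p2p : p ^+ 2 <= p by rewrite expr2; nra.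
pose y := 1 - p + r; pose L := (p + r) / (1 - y).
have y01 : 0 <= y < 1 by rewrite /y; apply/andP; split; lra.
have [y0 y1] := andP y01.
have yE : 1 - y = p - r by rewrite /y; ring.
have d0 : 0 < p - r by lra.
have L1 : 1 <= L by rewrite /L yE ler_pdivlMr//; lra.
have LE : L - 1 <= 4 * r / p.
  have -> : L - 1 = 2 * r / (p - r) by rewrite /L yE; field; rewrite gt_eqF.
  rewrite ler_pdivrMr// mulrAC ler_pdivlMr//; nra.
have rp : 4 * r / p <= p / 8.
  rewrite ler_pdivrMr//; nra.
have Ly : L * y <= 1 - p / 2.
  have : (L - 1) * y <= L - 1 by rewrite ler_piMr//; lra.
  by rewrite /y; lra.
exists r, (M * L * y / (1 - L * y) / (c / 2)); split => //; first by lra.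
move=> n; rewrite -/y -/L; apply: sum_coupling_bound_le => //.
- by lra.
- by lra.
move=> i.
apply: le_trans (return_mass_le _ _ _ _ _) _ => //; first by lra.
have h1 : c <= 1 - return_mass 1 y i 1.
  rewrite return_mass1; apply: le_trans (hc i) _.
  apply: ler_prod => j _; rewrite add1n subr_ge0 exprn_ile1//=; [|lra|lra].
  by rewrite lerB// lerXn2r// ?nnegrE /y; lra.
suff h2 : (L - 1) / ((1 - y) * (1 - L * y)) * y ^+ 1 <= c / 2 by lra.
rewrite expr1; apply: (@le_trans _ _ ((L - 1) / ((1 - y) * (1 - L * y)))).
  rewrite ler_piMr ?divr_ge0 ?mulr_ge0 ?subr_ge0//; lra.
have q0 : 0 < (1 - y) * (1 - L * y) by rewrite mulr_gt0; lra.
rewrite ler_pdivrMr//.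
have : p / 2 * (p / 2) <= (1 - y) * (1 - L * y) by apply: ler_pM; lra.
move=> /(ler_wpM2l (ltW c0)) h3.
apply: le_trans LE _; rewrite ler_pdivrMr//.
have -> : 4 * r = c / 2 * (p / 2 * (p / 2)) * p by rewrite /r; field.
rewrite ler_pM2r//; lra.
Qed.

End CouplingBound.

(** * Coupling of explorations started from lists with common top entries *)

Section Exploration.
Context {R : realType} {A : finType} (M vmin : R) (m v : A -> R).
Hypotheses (M0 : 0 < M) (m0 : forall a, 0 <= m a) (m1 : \sum_a m a = 1).
Hypotheses (vM : forall a, v a <= M).
Variables (p0 r : R).
Hypotheses (r0 : 0 < r) (rp0 : r < p0) (p01 : p0 <= 1).
Implicit Types (s t c : seq R) (b u : R) (f : R -> {poly R}).

(* Polynomials in [h], evaluated later at [p = p0 + h]; the scan stops at the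
   first edge of weight [M]. *)
Fixpoint explore f b s : {poly R} :=
  if s is z :: s' then
    (p0%:P + 'X) * f (Num.max b (z + M)) +
    ((1 - p0)%:P - 'X) * \sum_a m a *: explore f (Num.max b (z + v a)) s'
  else f b.

Fixpoint insert_desc u s :=
  if s is z :: s' then
    if z <= u then u :: s else z :: insert_desc u s'
  else [:: u].

Definition step_expect (F : seq R -> {poly R}) s : {poly R} :=
  explore (fun u => F (insert_desc u s)) (head 0 s + vmin) s.

(* The gain always lies in [0, M] on the lists that occur; clipping makes the
   bounds unconditional. *)
Definition clip u := Num.max 0 (Num.min M u).

Definition gain s : {poly R} :=
  explore (fun u => (clip (u - head 0 s))%:P) (head 0 s + vmin) s.

Definition gain_after n := iter n step_expect gain.

(** [x] and [y] are the norms of [p0 + 'X] and [1 - p0 - 'X]. [L] is the sum of the series of terms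
    [x * y ^+ i], the masses of the scans that stop after [i] failures. *)
Local Notation x := (p0 + r).
Local Notation y := (1 - p0 + r).
Local Notation L := (x / (1 - y)).
Local Notation nle := (poly_norm_le r).

Let y_lt1 : y < 1. Proof. by move: rp0; lra. Qed.
Let xE : x = L * (1 - y).
Proof. by rewrite divfK// subr_eq0 gt_eqF// y_lt1. Qed.
Let L_ge1 : 1 <= L.
Proof. by rewrite ler_pdivlMr ?subr_gt0 ?y_lt1//; move: r0; lra. Qed.

Lemma mix_const (P : {poly R}) :
  (p0%:P + 'X) * P + ((1 - p0)%:P - 'X) * \sum_a m a *: P = P.
Proof.
by rewrite -scaler_suml m1 scale1r -mulrDl polyCB; ring.
Qed.

Lemma poly_norm_le_mix G G' (P : {poly R}) (q : A -> {poly R}) :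
  nle G P -> (forall a, nle G' (q a)) ->
  nle (x * G + y * G')
    ((p0%:P + 'X) * P + ((1 - p0)%:P - 'X) * \sum_a m a *: q a).
Proof.
move=> hP hq.
have hs : nle G' (\sum_a m a *: q a).
  have -> : G' = \sum_a m a * G' by rewrite -mulr_suml m1 mul1r.
  apply: poly_norm_le_sum (ltW r0) _ => a.
  by rewrite -{1}(ger0_norm (m0 a)); apply: poly_norm_leZ.
have rr := ltW r0.
have -> : x * G + y * G' = (p0 * G + r * G) + ((1 - p0) * G' + r * G').
  by ring.
rewrite [_ * P]mulrDl [_ * \sum_a _]mulrBl.
have p0E : p0 = `|p0| by rewrite gtr0_norm//; move: r0 rp0; lra.
have q0E : 1 - p0 = `|1 - p0| by rewrite ger0_norm//; move: p01; lra.
apply: poly_norm_leD => //; apply: poly_norm_leD => //.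
- by rewrite mul_polyC {1}p0E; apply: poly_norm_leZ.
- exact: poly_norm_leXM.
- by rewrite mul_polyC {1}q0E; apply: poly_norm_leZ.
- by apply/poly_norm_leN/poly_norm_leXM.
Qed.

Lemma mix_sub (P P' : {poly R}) (q q' : A -> {poly R}) :
  ((p0%:P + 'X) * P + ((1 - p0)%:P - 'X) * \sum_a m a *: q a) -
  ((p0%:P + 'X) * P' + ((1 - p0)%:P - 'X) * \sum_a m a *: q' a) =
  (p0%:P + 'X) * (P - P') +
  ((1 - p0)%:P - 'X) * \sum_a m a *: (q a - q' a).
Proof.
have -> : \sum_a m a *: (q a - q' a) =
    \sum_a m a *: q a - \sum_a m a *: q' a.
  by rewrite -sumrB; apply: eq_bigr => a _; rewrite scalerBr.
ring.
Qed.

(** The scans may have different lengths: [mix_const] prolongs the one that has ended, and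
    [L = x + y * L] absorbs each further step. *)
Lemma explore_sub_le f f' G b b' s s' :
  (forall u u', nle G (f u - f' u')) ->
  nle (L * G) (explore f b s - explore f' b' s').
Proof.
move=> h; have G0 : 0 <= G := poly_norm_ge0 (h 0 0).
have LG : x * G + y * (L * G) = L * G by rewrite {1}xE; ring.
have GL : G <= L * G by rewrite ler_peMl// L_ge1.
elim: s s' b b' => [|z s IH] [|z' s'] b b' /=.
- exact: poly_norm_leW (h _ _).
- rewrite -[f b]mix_const mix_sub -LG; apply: poly_norm_le_mix => // a.
  elim: s' b b' (Num.max _ _) => [|z1 s' IH] b _ b' /=.
    exact: poly_norm_leW (h _ _).
  by rewrite -[f b]mix_const mix_sub -LG; apply: poly_norm_le_mix => // a'; apply: IH.
- rewrite -[f' b']mix_const mix_sub -LG; apply: poly_norm_le_mix => // a.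
  exact: (IH [::]).
- by rewrite mix_sub -LG; apply: poly_norm_le_mix => // a; apply: IH.
Qed.

Lemma explore_const (P : {poly R}) b s : explore (fun=> P) b s = P.
Proof.
elim: s b => [//|z s IH] b /=.
by under eq_bigr do rewrite IH; rewrite mix_const.
Qed.

Lemma explore_le f G b s : (forall u, nle G (f u)) -> nle (L * G) (explore f b s).
Proof.
move=> h; rewrite -[explore _ _ _]subr0 -(explore_const 0 b s).
by apply: explore_sub_le => u u'; rewrite subr0.
Qed.

(** Stopping within [c] yields a value above one of its entries, because [M] is positive. With
    [k = size c], these stops have mass [x * (1 + ... + y ^+ (k - 1))], that is [L * (1 - y ^+ k)];
    the scans going beyond [c] carry the factor [y ^+ k]. *)
Lemma explore_prefix_le f f' G G' b c t t' :
  (forall u, has (fun z => z <= u) c -> nle G (f u - f' u)) ->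
  (forall u u', nle G' (f u - f' u')) ->
  nle (L * ((1 - y ^+ size c) * G + y ^+ size c * G'))
    (explore f b (c ++ t) - explore f' b (c ++ t')).
Proof.
move=> h h'; elim: c b h => [|z c IH] b h /=.
  by rewrite expr0 subrr mul0r add0r mul1r; apply: explore_sub_le.
rewrite mix_sub.
have -> : L * ((1 - y ^+ (size c).+1) * G + y ^+ (size c).+1 * G') =
    x * G + y * (L * ((1 - y ^+ size c) * G + y ^+ size c * G')).
  by rewrite {2}xE exprS; ring.
apply: poly_norm_le_mix => [|a].
  by apply: h; rewrite /= le_max; apply/orP; left; apply/orP; right; move: M0; lra.
by apply: IH => u hu; apply: h; rewrite /= hu orbT.
Qed.

Lemma insert_desc_cat u c t : has (fun z => z <= u) c ->
  insert_desc u (c ++ t) = insert_desc u c ++ t.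
Proof. by elim: c => //= z c IH; case: ifP => //= _ /IH ->. Qed.

Lemma size_insert_desc u s : size (insert_desc u s) = (size s).+1.
Proof. by elim: s => //= z s IH; case: ifP => //= _; rewrite IH. Qed.

Lemma insert_desc_map w u s :
  insert_desc (u + w) (map (+%R^~ w) s) = map (+%R^~ w) (insert_desc u s).
Proof. by elim: s => //= z s IH; rewrite lerD2r IH; case: ifP. Qed.

Lemma explore_map f w b s :
  explore f (b + w) (map (+%R^~ w) s) = explore (fun u => f (u + w)) b s.
Proof.
have maxD b' z : Num.max (b' + w) (z + w) = Num.max b' z + w.
  by rewrite addr_maxl.
elim: s b => //= z s IH b; rewrite addrAC maxD; congr (_ + _ * _).
by apply: eq_bigr => a _; rewrite addrAC maxD IH.
Qed.

Lemma explore_ext f f' b s : f =1 f' -> explore f b s = explore f' b s.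
Proof.
move=> ff'; elim: s b => //= z s IH b; rewrite ff'.
by congr (_ + _ * _); apply: eq_bigr => a _; rewrite IH.
Qed.

(** Gains depend only on differences of weights. Two lists can thus be shifted until their top
    entries coincide. *)
Lemma gain_after_map n w s : s != [::] ->
  gain_after n (map (+%R^~ w) s) = gain_after n s.
Proof.
have hd s' : s' != [::] -> head 0 (map (+%R^~ w) s') = head 0 s' + w.
  by case: s'.
elim: n s => [|n IH] s s0; rewrite /gain_after/= /gain /step_expect hd//.
  rewrite addrAC explore_map; apply: explore_ext => u; congr (clip _)%:P.
  ring.
rewrite addrAC explore_map; apply: explore_ext => u.
by rewrite insert_desc_map; apply: IH; rewrite -size_eq0 size_insert_desc.
Qed.

Local Notation coupling_bound := (coupling_bound M L y).

Lemma clip_ge0 u : 0 <= clip u. Proof. by rewrite /clip le_max lexx. Qed.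
Lemma clip_leM u : clip u <= M.
Proof. by rewrite /clip ge_max ge_min lexx (ltW M0). Qed.

(** If the scan stops within [c], the new entry is inserted there and the common part grows by one.
    Otherwise a translation aligns the two top entries, and the induction resumes at depth 1. *)
Lemma gain_after_coupling n c t t' : c != [::] ->
  nle (coupling_bound n (size c)) (gain_after n (c ++ t) - gain_after n (c ++ t')).
Proof.
elim: n c t t' => [|n IH] c t t' c0.
  have hd t1 : head 0 (c ++ t1) = head 0 c by case: (c) c0.
  rewrite /gain_after/= /gain !hd.
  (* The gain of a single step sees only the head and the value found, so stops within [c]
     contribute no difference. *)
  have -> : y ^+ size c * M = (1 - y ^+ size c) * 0 + y ^+ size c * M by ring.
  apply: explore_prefix_le => [u _|u u'].
    by rewrite subrr -(normr0 R) -polyC0; apply: poly_norm_leC.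
  rewrite -polyCB; apply: poly_norm_leW (poly_norm_leC _ _).
  rewrite ler_norml; have := clip_ge0 (u - head 0 c).
  have := clip_ge0 (u' - head 0 c); have := clip_leM (u - head 0 c).
  have := clip_leM (u' - head 0 c); lra.
have hd t1 : head 0 (c ++ t1) = head 0 c by case: (c) c0.
rewrite /gain_after !iterS -/(gain_after n) /step_expect !hd.
apply: explore_prefix_le => [u hu|u u'].
  rewrite !insert_desc_cat// -(size_insert_desc u c); apply: IH.
  by rewrite -size_eq0 size_insert_desc.
have : insert_desc u (c ++ t) != [::] by rewrite -size_eq0 size_insert_desc.
have : insert_desc u' (c ++ t') != [::] by rewrite -size_eq0 size_insert_desc.
case: (insert_desc u' _) => // z' s' _; case: (insert_desc u _) => // z s _.
rewrite -(@gain_after_map n (z - z') (z' :: s'))//=.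
by rewrite (addrC z') subrK; apply: (IH [:: z]).
Qed.

Lemma gain_le s : nle (L * M) (gain s).
Proof.
apply: explore_le => u; apply: poly_norm_leW (poly_norm_leC _ _).
by rewrite ger0_norm ?clip_ge0 ?clip_leM.
Qed.

(** A first step turns [s] into [insert_desc u s], which up to a translation shares its top entry
    with [s], whatever [u] is. *)
Lemma gain_after_step n s : s != [::] ->
  nle (L * coupling_bound n 1) (gain_after n.+1 s - gain_after n s).
Proof.
move=> s0; rewrite -[gain_after n s](explore_const _ (head 0 s + vmin) s).
rewrite {1}/gain_after iterS -/(gain_after n); apply: explore_sub_le => u _.
have : insert_desc u s != [::] by rewrite -size_eq0 size_insert_desc.
case: (insert_desc _ _) => // z' s' _; case: s s0 => // z s _.
rewrite -(@gain_after_map n (z - z') (z' :: s'))//=.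
rewrite (addrC z') subrK; apply: (@gain_after_coupling _ [:: z]) => //.
Qed.

Lemma gain_after_le n s : s != [::] ->
  nle (L * (M + \sum_(j < n) coupling_bound j 1)) (gain_after n s).
Proof.
move=> s0; elim: n => [|n IH].
  by rewrite big_ord0 addr0; apply: gain_le.
rewrite big_ord_recr addrA mulrDr -[gain_after n.+1 s](subrKC (gain_after n s)).
by apply: poly_norm_leD (ltW r0) IH _; apply: gain_after_step.
Qed.

End Exploration.

Lemma sum_option (V : nmodType) (A : finType) (F : option A -> V) :
  \sum_o F o = F None + \sum_a F (Some a).
Proof.
rewrite (bigD1 None)//=; congr (_ + _).
rewrite (reindex_omap Some id)/=; last by case.
by apply: eq_bigl => a; rewrite eqxx.
Qed.

(** * Expected front as a sum of expected gains *)

Section HeadExpectation.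
Context {R : realType} {A : finType} (M vmin : R) (m v : A -> R).
Hypotheses (M0 : 0 < M) (m0 : forall a, 0 <= m a) (m1 : \sum_a m a = 1).
Hypotheses (vM : forall a, v a <= M) (vminM : vmin <= M).
Variable p0 : R.
Implicit Types (s : seq R) (b u : R).

Local Notation explore := (explore M m v p0).
Local Notation step_expect := (step_expect M vmin m v p0).
Local Notation gain := (gain M vmin m v p0).
Local Notation gain_after := (gain_after M vmin m v p0).

Definition head_expect n := iter n step_expect (fun s => (head 0 s)%:P).

(** Edges weigh at most [M], so the scan never leaves the range [u <= B]. With [B] the top entry
    plus [M], clipping at [M] then has no effect. *)
Lemma explore_ext_le f f' b s B : (forall u, u <= B -> f u = f' u) ->
  b <= B -> all (fun z => z + M <= B) s -> explore f b s = explore f' b s.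
Proof.
move=> ff'; elim: s b => [|z s IH] b bB /=; first by move=> _; apply: ff'.
move=> /andP[zB sB]; rewrite ff' ?ge_max ?bB//; congr (_ + _ * _).
apply: eq_bigr => a _; rewrite IH// ge_max bB/=; apply: le_trans zB.
by rewrite lerD2l.
Qed.

Lemma explore_add f f' b s :
  explore (fun u => f u + f' u) b s = explore f b s + explore f' b s.
Proof.
elim: s b => [//|z s IH] b /=.
under eq_bigr do rewrite IH scalerDr; rewrite big_split/=; ring.
Qed.

Lemma explore_sum (I : finType) (f : I -> R -> {poly R}) b s :
  explore (fun u => \sum_i f i u) b s = \sum_i explore (f i) b s.
Proof.
elim: s b => [//|z s IH] b /=; rewrite big_split -!mulr_sumr; congr (_ + _ * _).
by rewrite exchange_big; apply: eq_bigr => a _; rewrite IH scaler_sumr.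
Qed.

Lemma sorted_head_ge s z : sorted >=%R s -> z \in s -> z <= head 0 s.
Proof.
case: s => [//|t s] /= /order_path_min => /(_ ge_trans) /allP h.
by rewrite inE => /predU1P[->//|/h].
Qed.

Lemma head_insert_desc u s : s != [::] -> u <= head 0 s + M ->
  head 0 (insert_desc u s) = head 0 s + clip M (u - head 0 s).
Proof.
case: s => [//|z s] _ /= uM; rewrite /clip min_r; last by rewrite lerBlDl.
case: (leP z u) => zu /=; first by rewrite max_r ?subr_ge0// addrC subrK.
by rewrite max_l ?addr0// subr_le0 ltW.
Qed.

Lemma mem_insert_desc u s : insert_desc u s =i u :: s.
Proof.
elim: s => [//|z s IH] t /=; case: ifP => // _.
by rewrite inE IH !inE orbCA.
Qed.

Lemma perm_insert_desc u s : perm_eq (insert_desc u s) (u :: s).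
Proof.
elim: s => [//|z s IH] /=; case: ifP => // _.
apply: (@perm_trans _ (z :: u :: s)); first by rewrite perm_cons.
by rewrite -(cat1s z) -(cat1s u s) perm_catCA.
Qed.

Lemma sorted_insert_desc u s : sorted >=%R s -> sorted >=%R (insert_desc u s).
Proof.
elim: s => [//|z s IH] /= zs; case: (leP z u) => [zu|/ltW uz] /=; first by rewrite zu.
rewrite path_sortedE; last exact: ge_trans.
rewrite IH ?andbT; last exact: path_sorted zs.
apply/allP => t; rewrite mem_insert_desc inE => /predU1P[->//|].
by move: zs => /order_path_min => /(_ ge_trans)/allP; apply.
Qed.

Lemma step_expect_ext F F' s : sorted >=%R s ->
  (forall s', sorted >=%R s' -> s' != [::] -> F s' = F' s') ->
  step_expect F s = step_expect F' s.
Proof.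
move=> ss FF'; apply: explore_ext => u; apply: FF'.
  exact: sorted_insert_desc.
by rewrite -size_eq0 size_insert_desc.
Qed.

(** Peeling off the first step shifts every [gain_after j] to [gain_after j.+1]; the first step
    itself raises the head by [gain]. *)
Lemma head_expectE n s : sorted >=%R s -> s != [::] ->
  head_expect n s = (head 0 s)%:P + \sum_(j < n) gain_after j s.
Proof.
elim: n s => [|n IH] s ss s0; first by rewrite big_ord0 addr0.
rewrite /head_expect iterS -/(head_expect n) (step_expect_ext ss IH).
rewrite /step_expect explore_add explore_sum big_ord_recl addrA; congr (_ + _).
pose f u := (head 0 s)%:P + (clip M (u - head 0 s))%:P : {poly R}.
rewrite (@explore_ext_le _ f _ _ (head 0 s + M)).
- by rewrite explore_add explore_const.
- by move=> u us; rewrite head_insert_desc// polyCD.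
- by rewrite lerD2l.
- by apply/allP => z /(sorted_head_ge ss); rewrite lerD2r.
Qed.

Lemma head_expect_le r K n : 0 < r -> r < p0 -> p0 <= 1 ->
  (forall i, \sum_(j < i)
    coupling_bound M ((p0 + r) / (1 - (1 - p0 + r))) (1 - p0 + r) j 1 <= K) ->
  poly_norm_le r ((p0 + r) / (1 - (1 - p0 + r)) * (M + K) * n%:R)
    (head_expect n [:: 0]).
Proof.
move=> r0 rp0 p01 hK; rewrite head_expectE//= polyC0 add0r.
rewrite mulr_natr -[X in _ *+ X](card_ord n) -sumr_const.
apply: poly_norm_le_sum (ltW r0) _ => j.
apply: poly_norm_leW (gain_after_le vmin v M0 m0 m1 r0 rp0 p01 j _) => //.
rewrite ler_wpM2l ?lerD2l ?divr_ge0//; lra.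
Qed.

End HeadExpectation.

(** * Expectation of a complete scan *)

Section FullExpectation.
Context {R : realType} {B : finType} (w val : B -> R).
Implicit Types (f : R -> R) (s : seq R) (b u : R).

Fixpoint full_expect f b s : R :=
  if s is z :: s' then
    \sum_o w o * full_expect f (Num.max b (z + val o)) s'
  else f b.

Lemma full_expect_ext f f' b s : f =1 f' ->
  full_expect f b s = full_expect f' b s.
Proof.
move=> ff'; elim: s b => [|z s IH] b /=; first exact: ff'.
by apply: eq_bigr => o _; rewrite IH.
Qed.

Lemma full_expect_mid f b s1 z s2 :
  full_expect f b (s1 ++ z :: s2) = full_expect f b (z :: s1 ++ s2).
Proof.
elim: s1 b => [//|t s1 IH] b /=.
under eq_bigr do rewrite IH /= mulr_sumr.
rewrite exchange_big; apply: eq_bigr => o _; rewrite mulr_sumr.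
by apply: eq_bigr => o' _; rewrite mulrCA maxAC.
Qed.

(** The scan computes a maximum, for which the order is irrelevant. Vertices can thus be scanned by
    decreasing weight instead of by index. *)
Lemma full_expect_perm f b s s' : perm_eq s s' ->
  full_expect f b s = full_expect f b s'.
Proof.
elim: s s' b => [|z s IH] s' b; first by rewrite perm_sym => /perm_nilP ->.
move=> ss'; have : z \in s' by rewrite -(perm_mem ss') mem_head.
move=> zs'; case/splitPr: zs' ss' => s1 s2 ss'; rewrite full_expect_mid /=.
apply: eq_bigr => o _; congr (_ * _); apply: IH.
by move: ss'; rewrite perm_sym -cat1s perm_catCA/= perm_cons perm_sym.
Qed.

End FullExpectation.

(** * Successive integration of independent coordinates *)

Section IteratedExpectation.
Context {R : realType} {B : finType} {E : eqType} (w : B -> R).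
Implicit Types (es : seq E) (y : E -> B) (g : (E -> B) -> R).

Definition update y e o : E -> B := fun e' => if e' == e then o else y e'.

(** Expectation of [g] when the coordinates in [es] are independent of law [w] and the others are
    frozen at [y]. *)
Fixpoint iter_expect es g y : R :=
  if es is e :: es' then \sum_o w o * iter_expect es' g (update y e o) else g y.

Lemma iter_expect_cat es es' g y :
  iter_expect (es ++ es') g y = iter_expect es (iter_expect es' g) y.
Proof. by elim: es y => //= e es IH y; apply: eq_bigr => o _; rewrite IH. Qed.

Lemma iter_expect_ext es g g' y :
  (forall y', (forall e, e \notin es -> y' e = y e) -> g y' = g' y') ->
  iter_expect es g y = iter_expect es g' y.
Proof.
elim: es y => [|e es IH] y gg' /=; first exact: gg'.
apply: eq_bigr => o _; congr (_ * _); apply: IH => y' hy'; apply: gg' => e'.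
by rewrite inE negb_or => /andP[e'e e'es]; rewrite hy'// /update (negPf e'e).
Qed.

End IteratedExpectation.

(** * Vertex weights as a Markov chain on decreasing lists *)

Section Weights.
Context {R : realType} {B : finType} (w val : B -> R) (vmin : R).
Hypothesis vminP : forall o, vmin <= val o.
Local Notation env := (nat * nat -> B).
Implicit Types (y : env) (s : seq R) (F : seq R -> R).

(* [s] lists the weights of the vertices [i], [i + 1], etc. *)
Fixpoint best y n i b s : R :=
  if s is z :: s' then best y n i.+1 (Num.max b (z + val (y (i, n)))) s' else b.

Definition desc s := sort >=%R s.

(** The start value, front plus [vmin], never exceeds the candidate coming from the front vertex,
    since every edge weighs at least [vmin]. It leaves the maximum unchanged and is shifted along
    with the list. *)
Fixpoint weights y n : seq R :=
  if n is n'.+1 then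
    rcons (weights y n')
      (best y n 0 (head 0 (desc (weights y n')) + vmin) (weights y n'))
  else [:: 0].

Definition in_edges n := [seq (i, n) | i <- iota 0 n].
(** Edges are grouped by endpoint, so that one vertex after the other can be integrated out. *)
Definition edges_upto n := flatten [seq in_edges j | j <- iota 1 n].

Definition real_step F s : R :=
  full_expect w val (fun u => F (insert_desc u s)) (head 0 s + vmin) s.

Lemma size_weights y n : size (weights y n) = n.+1.
Proof. by elim: n => //= n IH; rewrite size_rcons IH. Qed.

Lemma sorted_desc s : sorted >=%R (desc s).
Proof. by apply: sort_sorted => ? ?; apply: real_leVge; apply: num_real. Qed.

Lemma desc_rcons s u : desc (rcons s u) = insert_desc u (desc s).
Proof.
apply: (sorted_eq ge_trans ge_anti) (sorted_desc _) _ _.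
  exact/sorted_insert_desc/sorted_desc.
rewrite perm_sort perm_sym (perm_trans (perm_insert_desc _ _))//.
by rewrite perm_sym perm_rcons perm_cons perm_sym perm_sort.
Qed.

Lemma best_ext y y' n i b s :
  (forall j, (i <= j < i + size s)%N -> y (j, n) = y' (j, n)) ->
  best y n i b s = best y' n i b s.
Proof.
elim: s i b => [//|z s IH] i b h /=; rewrite h; last by rewrite leqnn/= addnS ltnS leq_addr.
by apply: IH => j /andP[ij js]; apply: h; rewrite ltnW//= addnS -addSn.
Qed.

Lemma weights_ext y y' n :
  (forall e, (e.1 < e.2 <= n)%N -> y e = y' e) -> weights y n = weights y' n.
Proof.
elim: n => [//|n IH] h /=; have wE : weights y n = weights y' n.
  by apply: IH => e /andP[ee en]; apply: h; rewrite ee leqW.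
rewrite wE; congr rcons; apply: best_ext => j /= jn; apply: h.
by move: jn; rewrite size_weights add0n /= leqnn andbT.
Qed.

Lemma iter_expect_best f y n k b s :
  iter_expect w [seq (i, n) | i <- iota k (size s)]
    (fun y' => f (best y' n k b s)) y = full_expect w val f b s.
Proof.
elim: s y k b => [//|z s IH] y k b /=.
apply: eq_bigr => o _; congr (_ * _).
rewrite -(IH (update y (k, n) o) k.+1); apply: iter_expect_ext => y' ->.
  by rewrite /update eqxx.
apply/negP => /mapP[i]; rewrite mem_iota => /andP[ki _] [ik].
by rewrite ik ltnn in ki.
Qed.

Lemma edges_uptoS n : edges_upto n.+1 = edges_upto n ++ in_edges n.+1.
Proof.
have iotaS : iota 1 n.+1 = iota 1 n ++ [:: n.+1].
  by rewrite -[in LHS](addn1 n) iotaD add1n.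
rewrite /edges_upto iotaS map_cat flatten_cat.
by rewrite -[flatten [seq _ | _ <- [:: _]]]/(in_edges n.+1 ++ [::]) cats0.
Qed.

Lemma mem_in_edges n e : (e \in in_edges n) = (e.1 < n)%N && (e.2 == n).
Proof.
case: e => i j; apply/mapP/andP => /= [[k + [-> ->]]|[ij /eqP ->]].
  by rewrite mem_iota eqxx.
by exists i; rewrite ?mem_iota.
Qed.

Lemma mem_edges_upto n e : (e \in edges_upto n) = (e.1 < e.2 <= n)%N.
Proof.
elim: n => [|n IH]; first by rewrite leqn0; case: eqP => [->|]; rewrite ?andbF.
rewrite edges_uptoS mem_cat IH mem_in_edges [(e.2 <= n.+1)%N]leq_eqVlt ltnS.
by rewrite andb_orr orbC; congr (_ || _); case: eqP => [->|]; rewrite ?andbT ?andbF.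
Qed.

Lemma edges_upto_uniq n : uniq (edges_upto n).
Proof.
elim: n => [//|n IH]; rewrite edges_uptoS cat_uniq IH andTb; apply/andP; split.
  apply/hasPn => e; rewrite mem_in_edges mem_edges_upto => /andP[_ /eqP ->].
  by rewrite ltnn andbF.
by rewrite map_inj_uniq ?iota_uniq// => i j [].
Qed.

(** The edges into the last vertex form the innermost integration, with the earlier weights frozen;
    it amounts to one [real_step]. *)
Lemma iter_expect_weights F n y :
  iter_expect w (edges_upto n) (fun y' => F (desc (weights y' n))) y =
  iter n real_step F [:: 0].
Proof.
elim: n F y => [//|n IH] F y.
rewrite iterSr -(IH (real_step F) y) edges_uptoS iter_expect_cat.
apply: iter_expect_ext => y1 _; rewrite /real_step.
rewrite -(@full_expect_perm _ _ _ _ _ _ (weights y1 n)); last first.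
  by rewrite perm_sym perm_sort.
have -> : in_edges n.+1 = [seq (i, n.+1) | i <- iota 0 (size (weights y1 n))].
  by rewrite size_weights.
rewrite -(iter_expect_best _ y1 n.+1 0).
apply: iter_expect_ext => y2 h12 /=.
rewrite desc_rcons (@weights_ext y2 y1)// => -[i j] /= /andP[_ jn]; apply: h12.
by apply/negP => /mapP[k _ [_ jE]]; rewrite jE ltnn in jn.
Qed.

End Weights.

(** * Evaluation of the polynomials at a parameter *)

Section Evaluation.
Context {R : realType} {A : finType} (M vmin : R) (m v : A -> R).
Hypotheses (m1 : \sum_a m a = 1) (vM : forall a, v a <= M) (p0 : R).

(** [None] is reserved for the atom at [M]; the remaining mass [1 - p] is spread according to
    [m]. *)
Definition option_weight (p : R) (o : option A) : R :=
  if o is Some a then (1 - p) * m a else p.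
Definition option_val (o : option A) : R := if o is Some a then v a else M.

Lemma sum_option_weight p : \sum_o option_weight p o = 1.
Proof. by rewrite sum_option /= -mulr_sumr m1 mulr1 addrC subrK. Qed.

(* Once a maximal edge is met in a decreasing list, the later entries do not matter. *)
Lemma explore_full_expect f b s h : sorted >=%R s ->
  (explore M m v p0 f b s).[h] =
  full_expect (option_weight (p0 + h)) option_val (fun u => (f u).[h]) b s.
Proof.
elim: s b => [//|z s IH] b /= zs; rewrite sum_option /= !hornerE horner_sum.
congr (_ * _ + _); last first.
  rewrite mulr_sumr; apply: eq_bigr => a _.
  by rewrite hornerZ IH ?(path_sorted zs)// mulrA opprD addrA.
set b' := Num.max b (z + M).
have hb : forall t o, t \in s -> Num.max b' (t + option_val o) = b'.
  move=> t o ts; rewrite max_l// /b' le_max; apply/orP; right.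
  have tz : t <= z.
    by move: zs => /order_path_min => /(_ ge_trans)/allP; apply.
  by apply: lerD => //; case: o => //=.
elim: s hb {IH zs} => [//|t s IH] hb /=.
rewrite IH => [|t' o' t's]; last by rewrite hb// inE t's orbT.
under [RHS]eq_bigr do rewrite hb ?mem_head//.
by rewrite -mulr_suml sum_option_weight mul1r.
Qed.

Lemma head_expect_iter n h s : sorted >=%R s ->
  (head_expect M vmin m v p0 n s).[h] =
  iter n (real_step (option_weight (p0 + h)) option_val vmin) (head 0) s.
Proof.
elim: n s => [|n IH] s ss; first by rewrite hornerC.
rewrite /head_expect !iterS explore_full_expect//.
by apply: full_expect_ext => u; rewrite -IH// sorted_insert_desc.
Qed.

End Evaluation.

(** * Comparison of the front with last passage times *)

Section WeightsSpec.
Context {R : realType} {B : finType} (val : B -> R) (vmin : R).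
Hypothesis vminP : forall o, vmin <= val o.
Implicit Types (y : nat * nat -> B) (s : seq R).

Local Notation weights := (weights val vmin).
Local Notation best := (best val).

Definition weight y n := last 0 (weights y n).
Definition front y n := head 0 (desc (weights y n)).

Lemma nth_weights y n i : (i <= n)%N -> nth 0 (weights y n) i = weight y i.
Proof.
elim: n => [|n IH]; first by rewrite leqn0 => /eqP ->.
rewrite leq_eqVlt => /predU1P[->|].
  by rewrite /weight -nth_last size_weights.
by rewrite ltnS => ni; rewrite /= nth_rcons size_weights ltnS ni IH.
Qed.

Lemma weight_le_front y n i : (i <= n)%N -> weight y i <= front y n.
Proof.
move=> ni; apply: sorted_head_ge (sorted_desc _) _.
by rewrite mem_sort -(nth_weights y ni) mem_nth// size_weights.
Qed.

Lemma frontP y n : exists2 i, (i <= n)%N & front y n = weight y i.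
Proof.
have : front y n \in desc (weights y n).
  rewrite /front; have : desc (weights y n) != [::].
    by rewrite -size_eq0 size_sort size_weights.
  by case: desc => //= z s _; rewrite mem_head.
rewrite mem_sort => /(nthP 0)[i]; rewrite size_weights ltnS => ni <-.
by exists i => //; rewrite nth_weights.
Qed.

Lemma best_ge y n i b s : b <= best y n i b s.
Proof.
elim: s i b => //= z s IH i b; apply: le_trans (IH _ _).
by rewrite le_max lexx.
Qed.

Lemma best_ge_nth y n i b s j : (j < size s)%N ->
  nth 0 s j + val (y ((i + j)%N, n)) <= best y n i b s.
Proof.
elim: s i b j => //= z s IH i b [_|j js] /=.
  by rewrite addn0; apply: le_trans (best_ge _ _ _ _ _); rewrite le_max lexx orbT.
by rewrite -addSnnS; apply: IH.
Qed.

Lemma best_le_nth y n i b s : best y n i b s <= b \/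
  exists2 j, (j < size s)%N & best y n i b s <= nth 0 s j + val (y ((i + j)%N, n)).
Proof.
elim: s i b => [|z s IH] i b /=; first by left.
case: (IH i.+1 (Num.max b (z + val (y (i, n))))) => [h|[j js h]]; last first.
  by right; exists j.+1; rewrite // -addSnnS.
move: h; rewrite le_max => /orP[h|h]; first by left.
by right; exists 0; rewrite ?addn0.
Qed.

Lemma weight_ge y n i : (i < n)%N ->
  weight y i + val (y (i, n)) <= weight y n.
Proof.
case: n => // n; rewrite ltnS => ni.
rewrite -(nth_weights y ni) [weight y n.+1]last_rcons.
by rewrite -[X in y (X, _)]add0n; apply: best_ge_nth; rewrite size_weights.
Qed.

Lemma weight_le y n : exists2 i, (i <= n)%N &
  weight y n.+1 <= weight y i + val (y (i, n.+1)).
Proof.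
rewrite [weight y n.+1]last_rcons.
(* If the start value wins, the front vertex provides the predecessor, its edge weighing at least
   [vmin]. *)
case: (best_le_nth y n.+1 0 (head 0 (desc (weights y n)) + vmin) (weights y n)).
  have [i ni fE] := frontP y n; rewrite -/(front y n) fE => h; exists i => //.
  by apply: le_trans h _; rewrite lerD2l.
move=> [j]; rewrite size_weights ltnS => jn; rewrite add0n nth_weights// => h.
by exists j.
Qed.

Lemma weight_leM M y n : (forall o, val o <= M) -> 0 <= M -> weight y n <= n%:R * M.
Proof.
move=> valM M0; elim/ltn_ind: n => -[_|n IH]; first by rewrite mul0r.
have [i ni] := weight_le y n => /le_trans; apply.
apply: le_trans (lerD (IH i ni) (valM _)) _.
by rewrite -natr1 mulrDl mul1r lerD2r ler_wpM2r// ler_nat.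
Qed.

Lemma front_ge0 y n : 0 <= front y n.
Proof. exact: (weight_le_front y (leq0n n)). Qed.

Lemma front_leM M y n : (forall o, val o <= M) -> 0 <= M -> front y n <= n%:R * M.
Proof.
move=> valM M0; have [i ni ->] := frontP y n.
apply: le_trans (weight_leM y i valM M0) _.
by rewrite ler_wpM2r// ler_nat.
Qed.

Implicit Types (x : nat * nat -> \bar R).

Lemma path_weight_rcons x (i : nat) (s : seq nat) (n : nat) :
  path_weight x (rcons (i :: s) n) =
  (path_weight x (i :: s) + x (last i s, n))%E.
Proof.
rewrite /path_weight /=.
have -> : zip (i :: rcons s n) (rcons s n) = rcons (zip (i :: s) s) (last i s, n).
  by elim: s i => //= j s IH i; rewrite IH.
by rewrite big_rcons.
Qed.

(** A path from 0 to [n] has at most [n] edges, each losing at most [del]. *)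
Lemma path_weight_le x y del n (pi : seq nat) : 0 <= del ->
  (forall e, edges e -> (x e <= (val (y e) + del)%:E)%E) ->
  directed_paths 0 n pi -> (path_weight x pi <= (weight y n + n%:R * del)%:E)%E.
Proof.
move=> del0 xy; elim/last_ind: pi n => [|pi k IH] n []//.
case: pi IH => [|i s] IH.
  move=> _ /= [->] <-; rewrite /path_weight /= big_nil /weight/=.
  by rewrite mul0r addr0.
rewrite [sorted _ _]/= rcons_path => /andP[st lk] oh.
rewrite last_rcons => kn; rewrite kn in lk *.
rewrite path_weight_rcons.
have h1 := IH (last i s) _; have := xy (last i s, n) lk => h2.
apply: le_trans (leeD (h1 _) h2) _; first by split.
rewrite -EFinD lee_fin.
have h3 := weight_ge y lk.
have : (last i s).+1%:R * del <= n%:R * del by rewrite ler_wpM2r// ler_nat.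
rewrite -natr1 mulrDl mul1r; lra.
Qed.

(** Follow optimal predecessors back to 0. If [val] is below [x] on all edges met, they form the
    required path; an edge of weight at most [- L] gives the first alternative, the others weighing
    at most [M]. *)
Lemma weight_le_path x y M L n : 0 <= M ->
  (forall o, val o <= M) ->
  (forall e, edges e -> ((val (y e))%:E <= x e)%E \/ val (y e) <= - L) ->
  weight y n <= n%:R * M - L \/
  exists2 pi, directed_paths 0 n pi & ((weight y n)%:E <= path_weight x pi)%E.
Proof.
move=> M0 valM xy; elim/ltn_ind: n => -[_|n IH].
  by right; exists [:: 0]; rewrite // /path_weight big_nil.
have [i ni h] := weight_le y n.
have iM : i%:R * M + M <= n.+1%:R * M.
  by rewrite -natr1 mulrDl mul1r lerD2r ler_wpM2r// ler_nat.
case: (IH i ni) => [hi|[pi ppi hpi]].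
  left; apply: le_trans h _; have := valM (y (i, n.+1)); lra.
case: (xy (i, n.+1)) => // hx; last first.
  left; apply: le_trans h _; have := weight_leM y i valM M0; lra.
right; exists (rcons pi n.+1).
  case: pi ppi {hpi} => [[]//|k s] [/= st oh li].
  by split=> //=; rewrite ?last_rcons// rcons_path st li.
case: pi ppi hpi => [[]//|k s] [st oh li] hpi.
rewrite path_weight_rcons.
apply: (@le_trans _ _ ((weight y i)%:E + (val (y (i, n.+1)))%:E)%E).
  by rewrite -EFinD lee_fin.
by apply: leeD => //; move: li => /= ->.
Qed.

Lemma last_passage_le_front x y del n : 0 <= del ->
  (forall e, edges e -> (x e <= (val (y e) + del)%:E)%E) ->
  (last_passage x n <= (front y n + n%:R * del)%:E)%E.
Proof.
move=> del0 xy; apply: ge_ereal_sup => _ [pi ppi <-].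
apply: le_trans (path_weight_le del0 xy ppi) _.
by rewrite lee_fin lerD2r weight_le_front.
Qed.

(** Since [n * M <= L], the first alternative of [weight_le_path] forces a nonpositive weight. *)
Lemma front_le_last_passage x y M L n : 0 <= M -> n%:R * M <= L ->
  (forall o, val o <= M) ->
  (forall e, edges e -> ((val (y e))%:E <= x e)%E \/ val (y e) <= - L) ->
  front y n <= 0 \/
  exists2 i, (i <= n)%N & ((front y n)%:E <= last_passage x i)%E.
Proof.
move=> M0 ML valM xy; have [i ni ->] := frontP y n.
case: (weight_le_path i M0 valM xy) => [h|[pi ppi h]].
  left; apply: le_trans h _; rewrite subr_le0; apply: le_trans ML.
  by rewrite ler_wpM2r// ler_nat.
right; exists i => //; apply: le_trans h _.
by apply: ereal_sup_ubound; exists pi.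
Qed.

End WeightsSpec.

(** * Integration over finitely many independent random coordinates *)

Section CylinderExpectation.
Context d (T : measurableType d) (R : realType) (P : probability T R).
Context {B : finType} {E : eqType} (w : B -> R) (Y : E -> T -> B) (D : set E).
Hypothesis mY : forall e o, measurable [set t | Y e t = o].
Implicit Types (es cs : seq E) (y : E -> B) (g : (E -> B) -> R).

Definition cylinder cs y := [set t | forall e, e \in cs -> Y e t = y e].

Hypothesis wY : forall cs y, uniq cs -> [set` cs] `<=` D ->
  P (cylinder cs y) = (\prod_(e <- cs) w (y e))%:E.

(** The recursion mirrors that of [iter_expect], so that both can be compared by induction on
    [es]. *)
Fixpoint resample es y (t : T) : E -> B :=
  if es is e :: es' then resample es' (update y e (Y e t)) t else y.

Lemma resample_mem es y t e : e \in es -> resample es y t e = Y e t.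
Proof.
suff h es' y' : (e \in es') || (y' e == Y e t) -> resample es' y' t e = Y e t.
  by move=> ees; apply: h; rewrite ees.
elim: es' y' => [|e' es' IH] y' /=; first by move=> /eqP.
rewrite inE => h; apply: IH; rewrite /update; case: eqP h => [->|_] /=.
  by rewrite eqxx orbT.
by [].
Qed.

Lemma measurable_cylinder cs y : measurable (cylinder cs y).
Proof.
elim: cs => [|e cs IH].
  by rewrite (_ : cylinder _ _ = setT)//; apply/seteqP; split.
rewrite (_ : cylinder _ _ = [set t | Y e t = y e] `&` cylinder cs y).
  exact: measurableI.
apply/seteqP; split=> t /=.
  by move=> h; split=> [|e' e'cs]; apply: h; rewrite inE ?eqxx ?e'cs ?orbT.
by move=> [h1 h2] e'; rewrite inE => /predU1P[->//|]; apply: h2.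
Qed.

Lemma measurable_resample es g y :
  measurable_fun setT (fun t => g (resample es y t)).
Proof.
elim: es y => [|e es IH] y /=; first exact: measurable_cst.
(* As [B] is finite, the value at [e] can be split off by indicators. *)
rewrite (_ : (fun t => _) = (fun t => \sum_o
    \1_[set t | Y e t = o] t * g (resample es (update y e o) t))).
  apply: measurable_sum => o; apply: measurable_funM; last exact: IH.
  exact: measurable_indic.
apply/funext => t; rewrite (bigD1 (Y e t))//= big1 ?addr0.
  by rewrite indicE mem_set// mul1r.
move=> o /eqP oY; rewrite indicE memNset ?mul0r//=.
by move=> h; apply: oY.
Qed.

(** Splitting the cylinder by the value of [Y e] moves [e] from [es] to [cs]. Once [es] is exhausted
    the integrand is constant and [wY] gives the measure. *)
Lemma integral_resample_cylinder es cs g y : uniq (cs ++ es) ->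
  [set` cs ++ es] `<=` D ->
  (\int[P]_(t in cylinder cs y) (g (resample es y t))%:E =
   (\prod_(e <- cs) w (y e) * iter_expect w es g y)%:E)%E.
Proof.
elim: es cs y => [|e es IH] cs y.
  rewrite cats0 => ucs csD /=.
  rewrite integral_cst; last exact: measurable_cylinder.
  transitivity ((g y)%:E * (\prod_(e <- cs) w (y e))%:E)%E.
    by congr (_ * _)%E; exact: wY.
  by rewrite -EFinM mulrC.
move=> u csD.
have [ecs ees] : e \notin cs /\ e \notin es.
  move: u; rewrite cat_uniq /= negb_or => /and3P[_ /andP[-> _] /andP[-> _]].
  by [].
have cylE o t : cylinder (rcons cs e) (update y e o) t <->
    cylinder cs y t /\ Y e t = o.
  split=> [h|[h hY] e'].
    split=> [e' e'cs|]; last first.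
      by rewrite (h e) /update ?eqxx// mem_rcons mem_head.
    rewrite (h e') /update ?mem_rcons ?inE ?e'cs ?orbT//.
    by case: eqP => // e'e; rewrite -e'e e'cs in ecs.
  rewrite mem_rcons inE /update => /orP[/eqP ->|e'cs]; first by rewrite eqxx.
  by case: eqP => [->//|_]; apply: h.
have cylU : cylinder cs y =
    \big[setU/set0]_(o <- enum B) cylinder (rcons cs e) (update y e o).
  rewrite -bigcup_seq; apply/seteqP; split=> t.
    by move=> h; exists (Y e t); rewrite /= ?mem_enum//; apply/cylE.
  by move=> [b _] /cylE [].


rewrite cylU integral_bigsetU_EFin.
- rewrite big_enum /= mulr_sumr -sumEFin; apply: eq_bigr => o _.
  have -> : (\prod_(e0 <- cs) w (y e0)) * (w o * iter_expect w es g (update y e o))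
     = (\prod_(e0 <- rcons cs e) w (update y e o e0)) *
       iter_expect w es g (update y e o).
    rewrite big_rcons/= mulrA; congr (_ * _ * _); last by rewrite /update eqxx.
    apply: eq_big_seq => e' e'cs; rewrite /update.
    by case: eqP => // e'e; rewrite -e'e e'cs in ecs.
  rewrite -IH ?cat_rcons//; apply: eq_integral => t.
  by rewrite inE => /cylE[_ ->].
- by move=> o; apply: measurable_cylinder.
- exact: enum_uniq.
- by move=> o o' _ _ [t [/cylE[_ <-] /cylE[_ <-]]].
- apply/measurable_EFinP/measurable_funTS.
  exact: (measurable_resample (e :: es)).
Qed.

Lemma integral_resample es g y : uniq es -> [set` es] `<=` D ->
  (\int[P]_t (g (resample es y t))%:E = (iter_expect w es g y)%:E)%E.
Proof.
move=> ues esD; have := @integral_resample_cylinder es [::] g y ues esD.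
rewrite big_nil mul1r => <-; congr (integral _ _ _).
by apply/seteqP; split.
Qed.

End CylinderExpectation.

(** * Rounding of the edge weights *)

Section Quantization.
Context {R : realType} (M : R) (n : nat).
Hypothesis M0 : 0 < M.

(** Chosen so that rounding the at most [n] edges of a path costs at most [M] in total. *)
Definition mesh : R := M / n.+1%:R.
(** The shift [k.+1] keeps the levels strictly below [M], the value of [None]; the lowest level is
    [- n * M - mesh]. *)
Definition level (k : 'I_(n.+1 ^ 2).+1) : R := M - mesh * k.+1%:R.

(* Weights below the lowest level are rounded up to it; that level is so low
   that no edge of this weight lies on a path of nonnegative weight. *)
Definition quantize (x : \bar R) : option 'I_(n.+1 ^ 2).+1 :=
  if (M%:E <= x)%E then None
  else Some (odflt ord_max
    [pick k | ((level k)%:E <= x)%E && (x < (level k + mesh)%:E)%E]).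

Lemma mesh_gt0 : 0 < mesh. Proof. exact: divr_gt0. Qed.

Lemma level_leM k : level k <= M.
Proof. by rewrite lerBlDr lerDl mulr_ge0// ltW// mesh_gt0. Qed.

Lemma level_max_le k : level ord_max <= level k.
Proof. by rewrite lerD2l lerN2 ler_pM2l ?mesh_gt0// ler_nat ltnS leq_ord. Qed.

Lemma level_max_leN : level ord_max <= - (n%:R * M).
Proof.
have meshE : mesh * n.+1%:R = M by rewrite divfK// pnatr_eq0.
have -> : level ord_max = M - (M * n.+1%:R + mesh).
  by rewrite /level/= -{3}meshE -(natr1 (n.+1 ^ 2)%N) natrX; ring.
by rewrite -natr1; have := mesh_gt0; lra.
Qed.

Lemma quantize_le x : (x <= M%:E)%E ->
  (x <= (option_val M level (quantize x) + mesh)%:E)%E.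
Proof.
move=> xM; rewrite /quantize; case: (leP M%:E x) => [_|xltM] /=.
  by apply: le_trans xM _; rewrite lee_fin lerDl ltW// mesh_gt0.
case: pickP => [k /andP[_ /ltW]|] //= h.
have {}h k : ((level k)%:E <= x)%E = false \/ (x < (level k + mesh)%:E)%E = false.
  by have := h k; case: (_ <= _)%E; [right|left].
(* No level catches [x], so lying below [level k + mesh] forces lying below [level k], the upper end
   of the next interval; the descent starts at [M]. *)
suff : forall k : nat, (k < (n.+1 ^ 2).+1)%N ->
    (x < (M - mesh * k.+1%:R + mesh)%:E)%E.
  by move=> /(_ (n.+1 ^ 2)%N (ltnSn _))/ltW.
elim=> [_|k IH kn]; first by rewrite mulr1 subrK.
have /IH kx := ltnW kn.
have := h (Ordinal (ltnW kn)); rewrite /level/= kx => -[|//] /negbT.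
rewrite -ltNge; congr (_ < _%:E)%E.
by rewrite -(natr1 k.+1); ring.
Qed.

Lemma quantize_ge x : (x <= M%:E)%E ->
  ((option_val M level (quantize x))%:E <= x)%E \/
  option_val M level (quantize x) <= - (n%:R * M).
Proof.
move=> xM; rewrite /quantize; case: (leP M%:E x) => [Mx|xltM] /=; first by left.
case: pickP => [k /andP[h _]|_] /=; first by left.
by right; exact: level_max_leN.
Qed.

(** Rounding depends only on the finitely many truth values [S a x], so the preimage is a finite
    union of measurable cylinders. *)
Lemma measurable_quantize o : measurable [set x | quantize x = o].
Proof.
pose S (a : option 'I_(n.+1 ^ 2).+1) (x : \bar R) : bool :=
  if a is Some k then ((level k)%:E <= x)%E && (x < (level k + mesh)%:E)%E
  else (M%:E <= x)%E.
have mS a : measurable [set x | S a x].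
  have mle (c : R) : measurable [set x : \bar R | (c%:E <= x)%E].
    rewrite (_ : [set _ | _] = `[c%:E, +oo[%classic :> set (\bar R)).
      exact: emeasurable_itv.
    by apply/seteqP; split=> z /=; rewrite in_itv/= andbT.
  case: a => [k|]; last exact: mle.
  rewrite (_ : [set _ | _] = `[(level k)%:E, (level k + mesh)%:E[%classic).
    exact: emeasurable_itv.
  by apply/seteqP; split=> z /=; rewrite in_itv.
have mSb a b : measurable [set x | S a x = b].
  case: b; first exact: mS.
  rewrite (_ : [set _ | _] = ~` [set x | S a x]); first exact: measurableC.
  by apply/seteqP; split=> z /= => [->//|/negP/negbTE].
pose G (b : {ffun option 'I_(n.+1 ^ 2).+1 -> bool}) :=
  if b None then None else Some (odflt ord_max [pick k | b (Some k)]).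
rewrite (_ : [set _ | _] = \bigcup_(b in [set b | G b = o])
    cylinder S (enum {: option 'I_(n.+1 ^ 2).+1}) b).
  apply: fin_bigcup_measurable => [|b _]; first exact: finite_finset.
  exact: measurable_cylinder.
have GS (b : {ffun option 'I_(n.+1 ^ 2).+1 -> bool}) x :
    (forall a, S a x = b a) -> quantize x = G b.
  move=> Sb; rewrite /quantize /G -Sb /=; case: ifP => // _; congr (Some _).
  by congr odflt; apply: eq_pick => k; rewrite -Sb.
apply/seteqP; split=> x /=.
  move=> xo; exists [ffun a => S a x]; last by move=> a _; rewrite ffunE.
  by rewrite /= -(GS _ x)// => a; rewrite ffunE.
by move=> [b] /= <- Sb; apply: GS => a; apply: Sb; rewrite mem_enum.
Qed.

End Quantization.

(** * Law of the rounded weights *)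

Section LevelMass.
Context {R : realType} (M : R) (n : nat) (mu : probability (\bar R) R).
Hypotheses (M0 : 0 < M) (mu_lt_M : mu [set x : \bar R | (x < M%:E)%E] = 1%E).

Definition level_mass (k : 'I_(n.+1 ^ 2).+1) : R :=
  fine (mu [set x | quantize M n x = Some k]).

Let fin_mu o : mu [set x | quantize M n x = o] \is a fin_num.
Proof. exact/fin_num_measure/measurable_quantize. Qed.

Lemma level_mass_ge0 k : 0 <= level_mass k.
Proof. exact: fine_ge0. Qed.

Lemma quantize_None x :
  quantize M n x = None <-> (M%:E <= x)%E.
Proof. by rewrite /quantize; case: ifP. Qed.

Lemma measurable_lt_M : measurable [set x : \bar R | (x < M%:E)%E].
Proof.
rewrite (_ : [set _ | _] = `]-oo, M%:E[%classic :> set (\bar R)).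
  exact: emeasurable_itv.
by apply/seteqP; split=> z /=; rewrite in_itv.
Qed.

Lemma sum_level_mass : \sum_k level_mass k = 1.
Proof.
apply: EFin_inj; rewrite -sumEFin -mu_lt_M.
under eq_bigr do rewrite /level_mass fineK//.
rewrite -measure_bigsetU_ord; first last.
- by move=> k k' _ _ [x [/= -> []]].
- by move=> k; apply: measurable_quantize.
congr (mu _); rewrite -bigcup_seq; apply/seteqP; split=> x.
  by move=> [k _ /= xk]; rewrite ltNge; apply/negP => /quantize_None; rewrite xk.
rewrite /= ltNge => /negP Mx; case xk : (quantize M n x) => [k|].
  by exists k => //=; apply: mem_index_enum.
by case: Mx; exact/(proj1 (quantize_None x)).
Qed.

Lemma mixture_quantize p o :
  mixture mu M p [set x | quantize M n x = o] =
  (option_weight level_mass p o)%:E.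
Proof.
rewrite /mixture diracE; case: o => [k|] /=.
  rewrite memNset/=; last by rewrite /quantize lexx.
  by rewrite mule0 adde0 -[mu _]fineK// EFinM.
rewrite mem_set/=; last by apply/quantize_None.
have -> : mu [set x | quantize M n x = None] = 0%E.
  rewrite (_ : [set _ | _] = ~` [set x : \bar R | (x < M%:E)%E]).
    by rewrite probability_setC ?mu_lt_M ?subee//; exact: measurable_lt_M.
  apply/seteqP; split=> x /=; first by move/quantize_None; rewrite leNgt => /negP.
  by move/negP; rewrite -leNgt => ?; apply/quantize_None.
by rewrite mule0 add0e mule1.
Qed.

End LevelMass.

(** * Expected front of the rounded weights *)

Section FrontExpectation.
Context {R : realType} (M : R) (mu : probability (\bar R) R).
Hypotheses (M0 : 0 < M) (mu_lt_M : mu [set x : \bar R | (x < M%:E)%E] = 1%E).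
Context d (T : measurableType d) (P : probability T R) (p : R).
Context (X : nat * nat -> {RV P >-> \bar R}).
Hypothesis XP : iid_edge_weights (mixture mu M p) X.
Variable n : nat.

Local Notation B := (option 'I_(n.+1 ^ 2).+1).
Local Notation Y := (fun e t => quantize M n (X e t) : B).
Local Notation val := (option_val M (@level R M n)).
Local Notation vmin := (@level R M n ord_max).

Definition quantized_front t : R := front val vmin (fun e => quantize M n (X e t)) n.

Lemma measurable_quantize_RV e o : measurable [set t | Y e t = o].
Proof.
exact: (measurable_funPTI (X e) (measurable_quantize M o)).
Qed.

Lemma cylinder_quantize cs y : uniq cs -> [set` cs] `<=` edges ->
  P (cylinder Y cs y) =
  (\prod_(e <- cs) option_weight (@level_mass R M n mu) p (y e))%:E.
Proof.
case: XP => indep law ucs cse.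
pose S : {fset nat * nat} := [fset e in cs]%fset.
have SE e : (e \in S) = (e \in cs) by rewrite !inE.
have mB e : measurable [set x | quantize M n x = y e] := measurable_quantize M (y e).
rewrite (_ : cylinder _ _ _ =
    \bigcap_(e in [set` S]) (X e @^-1` [set x | quantize M n x = y e])).
  have -> := indep S _ _ mB; last by move=> e /=; rewrite SE; apply: cse.
  have SP : perm_eq S cs by apply: uniq_perm => // e; apply: SE.
  rewrite (perm_big _ SP) -prodEFin /=; apply: eq_big_seq => e ecs.
  by have := law e (cse e ecs) _ (mB e); rewrite (mixture_quantize mu_lt_M).
apply/seteqP; split=> t /= h e /=; first by rewrite SE; apply: h.
by move=> ecs; apply: h; rewrite /= SE.
Qed.

Lemma quantized_front_resample y t : quantized_front t =
  front val vmin (resample (fun e t => quantize M n (X e t)) (edges_upto n) y t) n.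
Proof.
rewrite /quantized_front /front; congr (head 0 (desc _)).
by apply: weights_ext => e en; rewrite resample_mem// mem_edges_upto.
Qed.

Lemma measurable_quantized_front : measurable_fun setT quantized_front.
Proof.
rewrite (_ : quantized_front = fun t => front val vmin
    (resample (fun e t => quantize M n (X e t)) (edges_upto n) (fun=> None) t) n).
  exact: (measurable_resample measurable_quantize_RV (edges_upto n)
    (fun y => front val vmin y n)).
by apply/funext => t; apply: quantized_front_resample.
Qed.

(** The centre [p0] is arbitrary: after evaluation only the sum of [p0] and [p - p0] enters. *)
Lemma expectation_quantized_front p0 :
  (\int[P]_t (quantized_front t)%:E =
   (head_expect M vmin (@level_mass R M n mu) (@level R M n) p0 n [:: 0]).[p - p0]%:E)%E.
Proof.
under eq_integral do rewrite (quantized_front_resample (fun=> None)).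
rewrite (integral_resample measurable_quantize_RV cylinder_quantize
  (fun y => front val vmin y n)); first last.
- by move=> e /=; rewrite mem_edges_upto => /andP[].
- exact: edges_upto_uniq.
congr EFin.
rewrite (head_expect_iter _ (sum_level_mass n mu_lt_M) (level_leM M0))//.
by rewrite (iter_expect_weights _ _ _ (head 0)) (addrC p0) subrK.
Qed.

End FrontExpectation.

(** * Convergence of the expected fronts *)

Section TimeConstant.
Context {R : realType}.

(** [lp n] bounds [F n] from below up to [K]. From above, [F n] is at most some [lp i]: for large
    [i] this is at most [(c + e / 2) * n], because [c] is nonnegative, and for small [i] it is
    bounded independently of [n]. *)
Lemma front_cvg (M K c : R) (lp : nat -> \bar R) (F : nat -> R) :
  0 <= K -> 0 <= M -> 0 <= c ->
  (forall n, 0 <= F n <= n%:R * M) ->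
  (forall n, (lp n <= (F n + K)%:E)%E) ->
  (forall n, F n <= 0 \/ exists2 i, (i <= n)%N & ((F n)%:E <= lp i)%E) ->
  ((lp n * (n%:R^-1)%:E)%E @[n --> \oo] --> c%:E) ->
  F n / n%:R @[n --> \oo] --> c.
Proof.
move=> K0 M0 c0 F0M lpF Flp lpc; apply/cvgrPdist_le => e e0.
have e20 : 0 < e / 2 by rewrite divr_gt0.
have hlt : nbhs c%:E [set z | (z < (c + e / 2)%:E)%E].
  apply: open_nbhs_nbhs; split; first exact: open_ereal_lt_ereal.
  by rewrite /= lte_fin ltrDl.
have hgt : nbhs c%:E [set z | ((c - e / 2)%:E < z)%E].
  apply: open_nbhs_nbhs; split; first exact: open_ereal_gt_ereal.
  by rewrite /= lte_fin ltrBlDr ltrDl.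
have [N1 _ hN1] := lpc _ hlt; have [N2 _ hN2] := lpc _ hgt.
have NM0 : 0 <= N1%:R * M by rewrite mulr_ge0.
have [N3 hN3] : exists N3 : nat, (N1%:R * M + K) / (e / 2) < N3%:R.
  exists (Num.bound ((N1%:R * M + K) / (e / 2))).
  by rewrite archi_boundP// divr_ge0 ?addr_ge0// ltW.
exists (maxn (maxn N1 N2) N3).+1 => // n /= hn.
have n0 : 0 < n%:R :> R by rewrite ltr0n (leq_trans _ hn).
have /andP[/andP[/ltnW n1 /ltnW n2] /ltnW n3] :
    (N1 < n)%N && (N2 < n)%N && (N3 < n)%N by rewrite -!gtn_max.
have hK : N1%:R * M + K <= n%:R * (e / 2).
  by rewrite -ler_pdivrMr//; apply: (le_trans (ltW hN3)); rewrite ler_nat.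
rewrite ler_distlC; apply/andP; split.
  rewrite ler_pdivlMr//.
  have /= := hN2 n n2; rewrite lte_pdivlMr// -EFinM => /lt_le_trans => /(_ _ (lpF n)).
  rewrite lte_fin => h.
  have -> : (c - e) * n%:R = (c - e / 2) * n%:R - n%:R * (e / 2) by field.
  lra.
rewrite ler_pdivrMr//.
have ce : 0 <= c * n%:R by rewrite mulr_ge0// ltW.
have en : 0 <= n%:R * (e / 2) by rewrite mulr_ge0// ltW.
have -> : (c + e) * n%:R = c * n%:R + n%:R * (e / 2) + n%:R * (e / 2) by field.
case: (Flp n) => [|[i ni]]; first by lra.
have [iN|Ni] := ltnP i N1.
  move=> /le_trans/(_ (lpF i)); rewrite lee_fin => h.
  have /andP[_ hi] := F0M i.
  have : i%:R * M <= N1%:R * M by rewrite ler_wpM2r// ler_nat ltnW.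
  lra.
(* At [i = 0] the quotient says nothing about [lp i]; [F 0 = 0] is used instead. *)
case: i ni Ni => [|i] ni Ni.
  move=> /le_trans/(_ (lpF 0%N)); rewrite lee_fin => h.
  have /andP[_] := F0M 0%N; rewrite mul0r; lra.
have /= := hN1 i.+1 Ni; rewrite lte_pdivrMr// -EFinM => hi /le_lt_trans/(_ hi).
rewrite lte_fin => h.
have : (c + e / 2) * i.+1%:R <= (c + e / 2) * n%:R.
  by rewrite ler_wpM2l ?ler_nat// addr_ge0// ltW.
have -> : (c + e / 2) * n%:R = c * n%:R + n%:R * (e / 2) by ring.
lra.
Qed.

Lemma ae_ex d (T : measurableType d) (P : probability T R) (Q : T -> Prop) :
  {ae P, forall t, Q t} -> exists t, Q t.
Proof.
move=> aeQ; apply: contrapT => /forallNP nQ.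
have : P.-negligible setT.
  by apply: negligibleS aeQ => t _ /=; apply: nQ.
move=> /negligibleP => /(_ measurableT) PT0.
have /eqP := etrans (esym (probability_setT P)) PT0.
by rewrite onee_eq0.
Qed.

Lemma last_passage_ge_edge (x : nat * nat -> \bar R) n :
  (x (0, n.+1)%N <= last_passage x n.+1)%E.
Proof.
apply: ereal_sup_ubound; exists [:: 0; n.+1]%N; first by split.
by rewrite /path_weight /= big_seq1.
Qed.

(** Rounding costs at most [n * mesh <= M], and weights raised to the lowest level fall under the
    alternative [- L] with [L = n * M]. *)
Lemma quantized_front_spec (M : R) (x : nat * nat -> \bar R) n : 0 < M ->
  (forall e, edges e -> (x e <= M%:E)%E) ->
  let F := front (option_val M (@level R M n)) (@level R M n ord_max)
    (fun e => quantize M n (x e)) n in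
  [/\ 0 <= F <= n%:R * M, (last_passage x n <= (F + M)%:E)%E &
    F <= 0 \/ exists2 i, (i <= n)%N & (F%:E <= last_passage x i)%E].
Proof.
move=> M0 xM F.
have vM o : option_val M (@level R M n) o <= M.
  by case: o => [k|] //=; exact: level_leM.
have vmin o : @level R M n ord_max <= option_val M (@level R M n) o.
  by case: o => [k|] /=; [exact: level_max_le|exact: level_leM].
split.
- by rewrite front_ge0//= front_leM// ltW.
- have xq e : edges e ->
      (x e <= (option_val M (@level R M n) (quantize M n (x e)) + mesh M n)%:E)%E.
    by move=> /xM; apply: quantize_le.
  apply: le_trans (last_passage_le_front (@level R M n ord_max) n (ltW (mesh_gt0 n M0)) xq) _.
  rewrite lee_fin -/F lerD2l /mesh mulrA ler_pdivrMr// mulrC ler_pM2l//.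
  by rewrite ler_nat.
- apply: (front_le_last_passage vmin (ltW M0) (lexx _) vM) => e /xM.
  exact: quantize_ge.
Qed.

Context (M : R) (mu : probability (\bar R) R).
Hypotheses (M0 : 0 < M) (mu_lt_M : mu [set x : \bar R | (x < M%:E)%E] = 1%E).

Lemma ae_le_max p d (T : measurableType d) (P : probability T R)
    (X : nat * nat -> {RV P >-> \bar R}) :
  iid_edge_weights (mixture mu M p) X ->
  {ae P, forall t, forall e, edges e -> (X e t <= M%:E)%E}.
Proof.
move=> [_ law].
have mgt : measurable [set x : \bar R | (M%:E < x)%E].
  rewrite (_ : [set _ | _] = `]M%:E, +oo[%classic :> set (\bar R)).
    exact: emeasurable_itv.
  by apply/seteqP; split=> z /=; rewrite in_itv/= andbT.
have mu0 : mu [set x : \bar R | (M%:E < x)%E] = 0%E.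
  apply: (@subset_measure0 _ _ _ mu _ (~` [set x : \bar R | (x < M%:E)%E])) => //.
  - exact/measurableC/measurable_lt_M.
  - by move=> x /=; rewrite ltNge => /negP Mx; apply/negP; rewrite -leNgt ltW// ltNge; apply/negP.
  - by apply: etrans (probability_setC mu (measurable_lt_M M)) _; rewrite mu_lt_M subee.
have ae1 e : edges e -> {ae P, forall t, (X e t <= M%:E)%E}.
  move=> ee; exists (X e @^-1` [set x : \bar R | (M%:E < x)%E]); split.
  - exact: measurable_funPTI.
  - apply: etrans (law e ee _ mgt) _; rewrite /mixture mu0 mule0 add0e diracE memNset ?mule0//=.
    by rewrite ltxx.
  - by move=> t /= /negP; rewrite -ltNge.
have : {ae P, forall t, forall i j, (i < j)%N -> (X (i, j) t <= M%:E)%E}.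
  apply: ae_foralln => i; apply: ae_foralln => j.
  have [ij|ji] := ltnP i j; last by apply: aeW.
  by apply: filterS (ae1 (i, j) ij).
by apply: filterS => t h [i j]; apply: h.
Qed.

Lemma prob_ge_max p d (T : measurableType d) (P : probability T R)
    (X : nat * nat -> {RV P >-> \bar R}) e :
  iid_edge_weights (mixture mu M p) X -> edges e ->
  P (X e @^-1` [set x : \bar R | (M%:E <= x)%E]) = p%:E.
Proof.
move=> [_ law] ee.
have -> : [set x : \bar R | (M%:E <= x)%E] = [set x | quantize M 0 x = None].
  by apply/seteqP; split=> x /(quantize_None M 0 x).
apply: etrans (law e ee _ (measurable_quantize _ _)) _.
by rewrite (mixture_quantize mu_lt_M).
Qed.

Lemma time_constant_limit p c : 0 < p -> is_time_constant (mixture mu M p) c ->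
  exists2 c0 : R, c = c0%:E & forall p0,
  (head_expect M (@level R M n ord_max) (@level_mass R M n mu) (@level R M n) p0 n [:: 0]).[p - p0] / n%:R
    @[n --> \oo] --> c0.
Proof.
move=> p_gt0 [d [T [P [X [XP aec]]]]].
have aeM := ae_le_max XP.
pose lp t n := last_passage (fun e => X e t) n.
have lp_le t n : (forall e, edges e -> (X e t <= M%:E)%E) -> (0 < n)%N ->
    (lp t n * (n%:R^-1)%:E <= (M + M)%:E)%E.
  move=> xM n0; rewrite lee_pdivrMr ?ltr0n//.
  have [/andP[_ FM] h _] := quantized_front_spec n M0 xM.
  apply: le_trans h _; rewrite -EFinM lee_fin.
  have : M <= M * n%:R by rewrite ler_pMr// ler1n.
  move: FM; rewrite mulrC; lra.
have cM : (c <= (M + M)%:E)%E.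
  rewrite leNgt; apply/negP => Mc.
  have [t [xM lpc]] : exists t, (forall e, edges e -> (X e t <= M%:E)%E) /\
      ((lp t n * (n%:R^-1)%:E)%E @[n --> \oo] --> c).
    by apply: (@ae_ex _ _ P); apply: filterS2 aeM aec.
  have [N _ hN] : \forall n \near \oo, ((M + M)%:E < lp t n * (n%:R^-1)%:E)%E.
    apply: (lpc [set z | ((M + M)%:E < z)%E]).
    by apply: open_nbhs_nbhs; split; first exact: open_ereal_gt_ereal.
  have := hN N.+1 (leqnSn N); rewrite /= ltNge.
  by rewrite (lp_le t N.+1 xM).
(* A single edge bounds the passage time from below. If [c] were negative, the edge from 0 to [n.+1]
   would almost surely weigh less than [M] for large [n]: the indicators of [S n] would tend to 0
   while their integrals all equal [p]. *)
have c0 : (0 <= c)%E.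
  rewrite leNgt; apply/negP => c_lt0.
  pose S n := X (0, n.+1)%N @^-1` [set x : \bar R | (M%:E <= x)%E].
  have mS n : measurable (S n).
    apply: measurable_funPTI.
    rewrite (_ : [set _ | _] = [set x | quantize M 0 x = None]).
      exact: measurable_quantize.
    by apply/seteqP; split=> x /(quantize_None M 0 x).
  have [] := @dominated_convergence _ _ _ P setT measurableT
    (fun n t => (\1_(S n) t)%:E) (cst 0%E) (cst 1%E).
  - by move=> n; exact/measurable_EFinP/measurable_indic.
  - exact: measurable_cst.
  - apply: filterS aec => t lpc _; apply: (@cvg_near_cst _ _ _ _ eventually).
    have [N _ hN] : \forall n \near \oo, (lp t n * (n%:R^-1)%:E < 0)%E.
      apply: (lpc [set z | (z < 0)%E]).
      by apply: open_nbhs_nbhs; split; first exact: open_ereal_lt_ereal.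
    exists N => // n /= Nn; rewrite indicE memNset// /S /= => Mx.
    have /= := hN n.+1 (leqW Nn).
    rewrite lte_pdivrMr// mul0e ltNge => /negP; apply.
    apply: le_trans (last_passage_ge_edge _ _); apply: le_trans Mx.
    by rewrite lee_fin ltW.
  - exact: finite_measure_integrable_cst.
  - apply: aeW => t n _ /=; rewrite lee_fin indicE.
    by case: (_ \in _); rewrite ?normr1 ?normr0 ?ler01.
  move=> _ _; rewrite integral0 (_ : [sequence _]_n = cst p%:E).
    move=> /(cvg_unique (@ereal_hausdorff R)) => /(_ _ (cvg_cst _)).
    by case=> p0; rewrite -p0 ltxx in p_gt0.
  apply/funext => n /=; rewrite integral_indic// setIT.
  exact: (prob_ge_max XP).
have cfin : c \is a fin_num.
  by rewrite ge0_fin_numE//; apply: le_lt_trans cM _; rewrite ltry.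
exists (fine c); first by rewrite fineK.
move=> p0; have c0E : c = (fine c)%:E by rewrite fineK.
have n_ge0 n : 0 <= (n%:R : R)^-1 by rewrite invr_ge0.
pose F n t := quantized_front M X n t.
have F0 n t : 0 <= F n t by exact: front_ge0.
have mF n : measurable_fun setT (F n) by exact: measurable_quantized_front.
(* Almost surely [F n / n] lies in [0, M] and tends to [c], so its expectation tends to [c] as
   well. *)
have [] := @dominated_convergence _ _ _ P setT measurableT
  (fun n t => (F n t / n%:R)%:E) (cst (fine c)%:E) (cst M%:E).
- move=> n; apply/measurable_EFinP; apply: measurable_funM => //.
- exact: measurable_cst.
- apply: filterS2 aeM aec => t xM lpc _; apply: cvg_EFin; first exact: nearW.
  apply: (@front_cvg M M (fine c) (lp t) (F ^~ t)).
  + exact: ltW.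
  + exact: ltW.
  + by rewrite fine_ge0.
  + by move=> n; have [] := quantized_front_spec n M0 xM.
  + by move=> n; have [] := quantized_front_spec n M0 xM.
  + by move=> n; have [] := quantized_front_spec n M0 xM.
  + by rewrite -c0E.
- exact: finite_measure_integrable_cst.
- apply: filterS aeM => t xM n _ /=; rewrite lee_fin ger0_norm ?mulr_ge0//.
  have [/andP[_ FM] _ _] := quantized_front_spec n M0 xM.
  case: n FM => [|n] FM; first by rewrite invr0 mulr0 ltW.
  by rewrite ler_pdivrMr ?ltr0n// mulrC.
have -> : (\int[P]_(x in setT) cst (fine c)%:E x = (fine c)%:E)%E.
  transitivity ((fine c)%:E * 1)%E; last by rewrite mule1.
  by rewrite integral_cst//; congr (_ * _)%E; exact: probability_setT.
move=> _ _; rewrite (_ : [sequence _]_n = fun n => ((head_expect M (@level R M n ord_max)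
  (@level_mass R M n mu) (@level R M n) p0 n [:: 0]).[p - p0] / n%:R)%:E).
  by move=> /fine_cvg.
apply/funext => n /=.
under eq_integral do rewrite EFinM.
rewrite ge0_integralZr//.
- by rewrite (expectation_quantized_front M0 mu_lt_M XP n p0) -EFinM.
- exact/measurable_EFinP.
- by move=> t _; rewrite lee_fin.
Qed.

End TimeConstant.

(** * Power series as limits of polynomials of bounded norm *)

Section BoundedCoefficients.
Context {R : realType}.

(** Writing [|h|] as [r * q], the terms from rank [N] on gain a factor [q ^+ N]. *)
Lemma horner_tail_le (P : {poly R}) r K h N : 0 < r -> poly_norm_le r K P ->
  `|h| < r ->
  `|P.[h] - \sum_(i < N) P`_i * h ^+ i| <= K * (`|h| / r) ^+ N.
Proof.
move=> r0 PK hr; set q := `|h| / r.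
have q0 : 0 <= q by rewrite divr_ge0// ltW.
have q1 : q <= 1 by rewrite ler_pdivrMr// mul1r ltW.
(* Padding with zero coefficients allows the split at [N] whatever the degree. *)
have -> : P.[h] = \sum_(i < N + size P) P`_i * h ^+ i.
  rewrite horner_coef -!(big_mkord xpredT (fun i => P`_i * h ^+ i)).
  rewrite (@big_cat_nat _ _ _ (size P) 0 (N + size P)) ?leq_addl//=.
  rewrite [X in _ + X]big_nat_cond [X in _ + X]big1 ?addr0// => i.
  by rewrite andbT => /andP[Pi _]; rewrite nth_default ?mul0r.
rewrite big_split_ord/= [_ - _]addrAC subrr add0r.
apply: (@le_trans _ _ (\sum_(i < N + size P) `|P`_i| * r ^+ i * q ^+ N)); last first.
  by rewrite -mulr_suml ler_wpM2r ?exprn_ge0//.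
rewrite big_split_ord/= ler_wpDl//.
  by apply: sumr_ge0 => i _; rewrite !mulr_ge0 ?exprn_ge0// ltW.
apply: le_trans (ler_norm_sum _ _ _) _; apply: ler_sum => i _.
rewrite normrM normrX.
have -> : `|h| = r * q by rewrite /q mulrC divfK// gt_eqF.
rewrite exprMn mulrA ler_wpM2l ?mulr_ge0 ?exprn_ge0 ?(ltW r0)//.
by rewrite exprD ler_piMr ?exprn_ge0 ?exprn_ile1.
Qed.

(** By Tychonoff's theorem the product of the segments is compact; closeness of the first [N]
    coordinates defines a neighbourhood of a cluster point. *)
Lemma bounded_coef_cluster (u : nat -> nat -> R) (b : nat -> R) :
  (forall n i, `|u n i| <= b i) ->
  exists2 a : nat -> R, (forall i, `|a i| <= b i) &
    forall N e m, 0 < e -> exists2 n, (m <= n)%N &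
      forall i, (i < N)%N -> `|a i - u n i| < e.
Proof.
move=> ub.
have cA := @tychonoff nat (fun=> R) (fun i => `[- b i, b i]%classic)
  (fun i => @segment_compact R _ _).
have [|a [Aa ca]] := cA (u @ \oo : set_system (prod_topology (fun=> R)))
    (fmap_proper_filter _ _).
  by exists 0%N => // n _ i /=; rewrite in_itv/= -ler_norml.
exists a => [i|N e m e0]; first by have := Aa i; rewrite /= in_itv/= -ler_norml.
pose V := [set g : prod_topology (fun=> R) | forall i : 'I_N, `|a i - g i| < e].
have nV : nbhs (a : prod_topology (fun=> R)) V.
  have near_i (i : 'I_N) :
      nbhs (a : prod_topology (fun=> R)) [set g | `|a i - g i| < e].
    exact: (@proj_continuous nat (fun=> R) i a _ (@nbhsx_ballx R R (a i) e e0)).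
  have nbhs_filt : Filter (nbhs (a : prod_topology (fun=> R))).
    exact: nbhs_filter.
  exact: (@filter_forall _ _ _ _ nbhs_filt near_i).
have nF : (u @ \oo) [set g | exists2 n, (m <= n)%N & g = u n].
  by exists m => // n /= mn; exists n.
have [g [[n mn ->] Vn]] := ca _ _ nF nV.
by exists n => // i iN; apply: (Vn (Ordinal iN)).
Qed.

(** A cluster point [a] of the coefficients inherits their geometric bounds, so its series
    converges. The values converge along the whole sequence; the uniform tail bound, at indices
    where the coefficients are close to [a], identifies the sum as [f h]. *)
Lemma bounded_poly_limit (P : nat -> {poly R}) r K (D : set R) (f : R -> R) :
  0 < r -> (forall n, poly_norm_le r K (P n)) ->
  (forall h, D h -> `|h| < r -> (P n).[h] @[n --> \oo] --> f h) ->
  exists2 a : nat -> R, (forall y, `|y| < r -> cvgn (pseries a y)) &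
    forall h, D h -> `|h| < r -> f h = limn (pseries a h).
Proof.
move=> r0 PK Pf.
have K0 : 0 <= K := poly_norm_ge0 (PK 0%N).
have [|a ab ha] := @bounded_coef_cluster (fun n i => (P n)`_i) (fun i => K / r ^+ i).
  move=> n i; rewrite ler_pdivlMr ?exprn_gt0//.
  exact: poly_norm_coef (ltW r0) (PK n).
have q1 y : `|y| < r -> `| `|y| / r | < 1.
  by move=> yr; rewrite ger0_norm ?divr_ge0 ?(ltW r0)// ltr_pdivrMr// mul1r.
exists a => [y yr|h Dh hr].
  apply: normed_cvg.
  apply: (@series_le_cvg R _ (geometric K (`|y| / r))) => [i|i|i|].
  - exact: normr_ge0.
  - by rewrite /= mulr_ge0// exprn_ge0// divr_ge0// ltW.
  - rewrite /= normrM normrX expr_div_n mulrA [leRHS]mulrAC.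
    by rewrite ler_wpM2r ?exprn_ge0.
  - exact/is_cvg_geometric_series/q1.
apply/esym/cvg_lim => //.
have q0 : 0 <= `|h| / r by rewrite divr_ge0// ltW.
have tail N : `|f h - \sum_(i < N) a i * h ^+ i| <= K * (`|h| / r) ^+ N.
  apply/ler_addgt0Pr => e e0.
  (* The summand 1 keeps [B] positive when [N = 0]. *)
  pose B := 1 + \sum_(i < N) `|h| ^+ i.
  have B0 : 0 < B by rewrite ltr_pwDl// sumr_ge0// => i _; rewrite exprn_ge0.
  have e1 : 0 < e / 2 / B by rewrite !divr_gt0.
  have [m _ hm] : \forall n \near \oo, `|f h - (P n).[h]| < e / 2.
    by move: (Pf h Dh hr) => /cvgrPdist_lt; apply; rewrite divr_gt0.
  have [n mn hn] := ha N _ m e1.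
  have h1 := hm n mn.
  have h2 := horner_tail_le N r0 (PK n) hr.
  have h3 : `|\sum_(i < N) (P n)`_i * h ^+ i - \sum_(i < N) a i * h ^+ i| <= e / 2.
    rewrite -sumrB; apply: le_trans (ler_norm_sum _ _ _) _.
    apply: (@le_trans _ _ (\sum_(i < N) e / 2 / B * `|h| ^+ i)).
      apply: ler_sum => i _; rewrite -mulrBl normrM normrX ler_wpM2r ?exprn_ge0//.
      by rewrite distrC ltW// hn.
    rewrite -mulr_sumr mulrAC ler_pdivrMr// ler_wpM2l ?ltW ?divr_gt0//.
    by rewrite /B; lra.
  have -> : f h - \sum_(i < N) a i * h ^+ i = (f h - (P n).[h]) +
    ((P n).[h] - \sum_(i < N) (P n)`_i * h ^+ i) +
    (\sum_(i < N) (P n)`_i * h ^+ i - \sum_(i < N) a i * h ^+ i) by ring.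
  apply: le_trans (ler_normD _ _) _.
  have := ler_normD (f h - (P n).[h]) ((P n).[h] - \sum_(i < N) (P n)`_i * h ^+ i).
  move: h1 h2 h3 => /=; lra.
apply/cvgrPdist_le => e e0.
have : geometric K (`|h| / r) @ \oo --> (0 : R) by apply: cvg_geometric; exact: q1.
move=> /cvgrPdist_le/(_ e e0); apply: filterS => N /=.
rewrite sub0r normrN ger0_norm ?mulr_ge0 ?exprn_ge0// => hN.
rewrite /pseries /series /= big_mkord.
exact: le_trans (tail N) hN.
Qed.

End BoundedCoefficients.

(** * Analyticity of the time constant *)

Unset Implicit Arguments.

Theorem theorem1p6 (R : realType) (M : R) (mu : probability (\bar R) R)
    (M_gt0 : 0 < M) (mu_lt_M : mu [set x : \bar R | (x < M%:E)%E] = 1%E)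
    (C : R -> \bar R)
    (C_time_constant : forall p : R, 0 < p <= 1 ->
      is_time_constant (mixture mu M p) (C p)) :
  analytic_on [set p : R | 0 < p <= 1] C.
Proof.
have C_lim p : 0 < p <= 1 -> exists2 c : R, C p = c%:E & forall p0,
    (head_expect M (@level R M n ord_max) (@level_mass R M n mu) (@level R M n) p0 n
      [:: 0]).[p - p0] / n%:R @[n --> \oo] --> c.
  move=> p01; apply: time_constant_limit => //; last exact: C_time_constant.
  by case/andP: p01.
move=> p0 /= p0_01; have [p0_gt0 p0_le1] := andP p0_01.
have [r [K [r0 rp0 hK]]] := coupling_bound_summable (ltW M_gt0) p0_01.
pose P n := (n%:R)^-1 *: head_expect M (@level R M n ord_max)
  (@level_mass R M n mu) (@level R M n) p0 n [:: 0].
set K' := (p0 + r) / (1 - (1 - p0 + r)) * (M + K).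
have K0 : 0 <= K by have := hK 0%N; rewrite big_ord0.
have K'0 : 0 <= K'.
  have x0 : 0 <= p0 + r by lra.
  have y1 : 0 <= 1 - (1 - p0 + r) by lra.
  by rewrite mulr_ge0 ?divr_ge0// addr_ge0// ltW.
have PK n : poly_norm_le r K' (P n).
  have h := head_expect_le M_gt0 (@level_mass_ge0 R M n mu)
    (sum_level_mass n mu_lt_M) (level_leM M_gt0)
    (@level_leM R M n M_gt0 ord_max) n r0 rp0 p0_le1 hK.
  apply: (poly_norm_leW _ (poly_norm_leZ _ h)).
  rewrite -/K' ger0_norm ?invr_ge0//.
  (* At [n = 0] the inverse is 0 and the bound is trivial. *)
  case: (n) => [|i]; first by rewrite invr0 mul0r.
  by rewrite mulrC mulfK// pnatr_eq0.
(* Convergence is available for parameters in (0, 1] only, hence the restriction on [h]; at [p0 = 1]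
   it is one-sided. *)
have [|a acvg aE] := @bounded_poly_limit R P r K'
    [set h | 0 < p0 + h <= 1] (fun h => fine (C (p0 + h))) r0 PK _.
  move=> h h01 _; have [c -> /(_ p0)] := C_lim _ h01.
  rewrite (addrC p0) addrK /= => hc; apply: cvg_trans hc.
  by under eq_fun do rewrite hornerZ mulrC.
exists a, r; split => // x x01 xr.
have [c Cx _] := C_lim x x01.
have xE : p0 + (x - p0) = x by rewrite addrC subrK.
by have := aE (x - p0); rewrite /= xE Cx => /(_ x01 xr) <-.
Qed.
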